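(* Let $a,b$ be constants and let $\nu$ be such that $\nu(\nu+1)=4b$. If $a$ and $b$ are such that the connection matrices of the equation $$\left[\frac{d^2}{d\beta^2}-\frac{\tan\beta}{2}\frac{d}{d\beta}+\frac{a}{\cos\beta}+b\right]T(\beta)=0\qquad(\ast)$$ (defined in the context) satisfy $\mathsf m_{1,1}=0$ and $\mathsf n_{1,2}=0$, then there exist non-trivial solutions $T^L(\chi)$ and $T^R(\tau)$ of the (Lamé) equations $$\left[\frac{d^2}{d\chi^2}+\frac{\cos\chi\sin\chi}{2-\cos^2\chi}\frac{d}{d\chi}+\frac{\nu(\nu+1)\sin^2\chi}{2-\cos^2\chi}-\frac{4a}{2-\cos^2\chi}\right]T^L(\chi)=0,$$ $$\left[\frac{d^2}{d\tau^2}+\frac{\cos\tau\sin\tau}{2-\cos^2\tau}\frac{d}{d\tau}+\frac{\nu(\nu+1)\sin^2\tau}{2-\cos^2\tau}+\frac{4a}{2-\cos^2\tau}\right]T^R(\tau)=0,$$ respectively, such that $$T^L(\chi)=T^L(-\chi),\quad T^L(\chi)=T^L(2\pi-\chi),\qquad T^R(\tau)=T^R(-\tau),\quad T^R(\tau)=-T^R(2\pi-\tau).$$ Conversely, if such non-trivial solutions $T^L$ and $T^R$ exist, then $\mathsf m_{1,1}=0$ and $\mathsf n_{1,2}=0$.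
   Context: The points $\beta_0\in\{-\pi/2,\pi/2,3\pi/2\}$ are regular singular points of $(\ast)$ with exponents $(0,1/2)$. At each there is a basis of solutions, the first element holomorphic at $\beta_0$, the second being $(\beta-\beta_0)^{1/2}$ times a function holomorphic at $\beta_0$: $$B_{-\pi/2}=\begin{pmatrix}\psi_{1,1}(\beta+\pi/2)\\(\beta+\pi/2)^{1/2}\psi_{2,1}(\beta+\pi/2)\end{pmatrix},\ B_{\pi/2}=\begin{pmatrix}\psi_{1,2}(\beta-\pi/2)\\(\beta-\pi/2)^{1/2}\psi_{2,2}(\beta-\pi/2)\end{pmatrix},\ B_{3\pi/2}=\begin{pmatrix}\psi_{1,3}(\beta-3\pi/2)\\(\beta-3\pi/2)^{1/2}\psi_{2,3}(\beta-3\pi/2)\end{pmatrix},$$ with $\psi_{m,n}$ holomorphic near $0$. The constant $2\times2$ connection matrices $\mathsf M=(\mathsf m_{j,\ell})$ and $\mathsf N=(\mathsf n_{j,\ell})$ are defined by $B_{\pi/2}=\mathsf M B_{-\pi/2}=\mathsf N B_{3\pi/2}$ (continuation along the real segments joining neighbouring points). The equations for $T^L$ and $T^R$ are obtained from $(\ast)$ via $T^L(\chi(\beta))=T(\beta)$ with $\chi(\beta)=\arccos(\sqrt2\cos(\beta/2))$, which maps $[\pi/2,3\pi/2]$ onto $[0,\pi]$, and $T^R(\tau(\beta))=T(\beta)$ with $\tau(\beta)=\arccos(\sqrt2\sin(\beta/2))$, which maps $[-\pi/2,\pi/2]$ onto $[0,\pi]$. *)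

(* Defs.v *)
From Stdlib Require Import Reals.
From Coquelicot Require Import Coquelicot.
Open Scope R_scope.

(* [T'' + p T' + q T = 0] on the open interval (lo, hi) of the real line, for
   complex-valued [T], with derivatives taken in C viewed as a real normed
   space.  Values of [T] outside the interval are irrelevant; the bounds lie in
   Rbar so that the interval may be the whole line. *)
Definition solves_linear_ode (p q : R -> C) (lo hi : Rbar) (T : R -> C) : Prop :=
  exists dT ddT : R -> C,
    forall x : R, Rbar_lt lo x -> Rbar_lt x hi ->
      @is_derive R_AbsRing C_R_NormedModule T x (dT x) /\
      @is_derive R_AbsRing C_R_NormedModule dT x (ddT x) /\
      (ddT x + p x * dT x + q x * T x = 0)%C.

Definition solves_star (a b : C) : Rbar -> Rbar -> (R -> C) -> Prop :=
  solves_linear_ode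
    (fun beta => (- RtoC (tan beta / 2))%C)
    (fun beta => (a / RtoC (cos beta) + b)%C).

(* The Lamé equation with constant numerator [c]; the two equations of interest
   are [c = -4a] and [c = 4a]. *)
Definition solves_lame (nu c : C) : (R -> C) -> Prop :=
  solves_linear_ode
    (fun x => RtoC (cos x * sin x / (2 - cos x ^ 2)))
    (fun x => (nu * (nu + 1) * RtoC (sin x ^ 2 / (2 - cos x ^ 2))
               + c / RtoC (2 - cos x ^ 2))%C)
    m_infty p_infty.

Definition nontrivial (T : R -> C) : Prop := exists x : R, T x <> RtoC 0.

Definition holomorphic_near_0 (psi : C -> C) : Prop :=
  locally (RtoC 0) (fun z => @ex_derive C_AbsRing C_NormedModule psi z).

(* [x ^ (1/2)] for real [x], principal branch. *)
Definition sqrtRC (x : R) : C :=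
  if Rle_dec 0 x then RtoC (sqrt x) else (Ci * RtoC (sqrt (- x)))%C.

(* Matrices are indexed from 0. *)
Definition entry {m n : nat} (A : @matrix C_Ring m n) (i j : nat) : C :=
  coeff_mat (RtoC 0) A i j.

(* The column vector
     ( psi1 (beta - beta0) , (beta - beta0)^(1/2) * psi2 (beta - beta0) ). *)
Definition frobenius_vector (beta0 : R) (psi1 psi2 : C -> C) (beta : R)
  : @matrix C_Ring 2 1 :=
  mk_matrix 2 1 (fun i _ =>
    match i with
    | O => psi1 (RtoC (beta - beta0))
    | _ => (sqrtRC (beta - beta0) * psi2 (RtoC (beta - beta0)))%C
    end).

Definition basis_of_solutions (a b : C) (lo hi : R)
    (B : R -> @matrix C_Ring 2 1) : Prop :=
  solves_star a b lo hi (fun beta => entry (B beta) 0 0) /\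
  solves_star a b lo hi (fun beta => entry (B beta) 1 0) /\
  forall T : R -> C, solves_star a b lo hi T ->
    exists! c : C * C, forall beta : R, lo < beta < hi ->
      T beta = (fst c * entry (B beta) 0 0 + snd c * entry (B beta) 1 0)%C.

(* [beta0] is a singular point, so on the real line the basis property is asked
   for on each side of it; [r <= PI] keeps the other singular points out. *)
Definition frobenius_basis (a b : C) (beta0 : R) (psi1 psi2 : C -> C) : Prop :=
  holomorphic_near_0 psi1 /\ holomorphic_near_0 psi2 /\
  exists r : R, 0 < r <= PI /\
    basis_of_solutions a b (beta0 - r) beta0 (frobenius_vector beta0 psi1 psi2) /\
    basis_of_solutions a b beta0 (beta0 + r) (frobenius_vector beta0 psi1 psi2).

(* [U] is the continuation, as a vector of solutions on the whole segment
   (lo, hi), of the vector [B] given near the endpoint [beta0]. *)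
Definition continuation (a b : C) (lo hi beta0 : R)
    (B U : R -> @matrix C_Ring 2 1) : Prop :=
  solves_star a b lo hi (fun beta => entry (U beta) 0 0) /\
  solves_star a b lo hi (fun beta => entry (U beta) 1 0) /\
  exists r : R, 0 < r /\
    forall beta : R, lo < beta < hi -> Rabs (beta - beta0) < r ->
      U beta = B beta.

(* [B = A B'] on the segment (lo, hi), where [B] is given near the endpoint
   [beta0], [B'] near the endpoint [beta1], and both are continued along the
   segment. *)
Definition connection_matrix (a b : C) (lo hi : R)
    (beta0 : R) (B : R -> @matrix C_Ring 2 1)
    (beta1 : R) (B' : R -> @matrix C_Ring 2 1)
    (A : @matrix C_Ring 2 2) : Prop :=
  exists U U' : R -> @matrix C_Ring 2 1,
    continuation a b lo hi beta0 B U /\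
    continuation a b lo hi beta1 B' U' /\
    forall beta : R, lo < beta < hi -> U beta = Mmult A (U' beta).

(* Main.v *)
Require Import Defs.
From Stdlib Require Import Reals Lra Psatz Classical.
From Coquelicot Require Import Coquelicot.
Open Scope R_scope.

(** The point of the proof is that the changes of variable [chi] and [tau]
    remove the singular points: the Lamé equations have smooth coefficients on
    the whole line, so a local exponent at a singular point turns into a parity
    of a Lamé solution about a multiple of [PI].

    Write [beta = beta0 + eps * t] near a singular point [beta0], with [t > 0]
    and [eps] equal to 1 or -1, and let [t = gap s] be the inverse of the change
    of variable; then [sin (gap s) = sin s ^ 2], so [gap s] behaves like [s ^ 2]
    at 0.  The element of a Frobenius basis with exponent 0 becomes a function
    of [s] with zero derivative at [0], the one with exponent 1/2 becomes
    [sqrt (gap s)] times a bounded function and vanishes at [0].  A Lamé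
    solution on a punctured neighbourhood of a point that is differentiable at
    the point is a solution across it ([lame_removable]), hence the first
    element extends to an even solution and the second one to an odd solution.
    Conversely the part of a symmetric solution that lies along the wrong basis
    element has zero Cauchy data at [0], so it vanishes by uniqueness
    ([lame_zero_jet], [parity_solution_multiple]).

    Now let [u] be the continuation to a whole segment of the exponent-0
    solution at [PI / 2].  In the Lamé variable it lives on [(0, PI)] and is
    even at the end [0].  At the other end it is [m v + m' w], where [v] has the
    required parity and [w] the opposite one.  If [m' = 0], folding the line
    onto [[0, PI]] extends [u] to a global solution with the required symmetries
    ([lame_extend]); conversely, a global symmetric solution is a multiple both
    of [u] and of [v], so [m' = 0] by independence ([matching]).  The equation
    for [T^L] is the segment to the right of [PI / 2] with an even end at
    [3 PI / 2], so [m'] is the second entry of the first row of [N]; the one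
    for [T^R] is the segment to the left with an odd end at [- PI / 2], so [m']
    is the first entry of the first row of [M]. *)

(** * Derivatives of complex-valued functions of a real variable *)

Notation derivC := (@is_derive R_AbsRing C_R_NormedModule).

Lemma derivC_iff (T : R -> C) (x : R) (l : C) :
  derivC T x l <->
  is_derive (fun t => fst (T t)) x (fst l) /\
  is_derive (fun t => snd (T t)) x (snd l).
Proof.
  split.
  - intros H. split.
    + exact (@filterdiff_comp' R_AbsRing R_NormedModule C_R_NormedModule R_NormedModule
               T fst x _ fst H (filterdiff_linear _ (@is_linear_fst R_AbsRing R_NormedModule R_NormedModule))).
    + exact (@filterdiff_comp' R_AbsRing R_NormedModule C_R_NormedModule R_NormedModule
               T snd x _ snd H (filterdiff_linear _ (@is_linear_snd R_AbsRing R_NormedModule R_NormedModule))).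
  - intros [H1 H2].
    assert (Hid : filterdiff
      (fun t : prod_NormedModule R_AbsRing R_NormedModule R_NormedModule => (fst t, snd t) : C_R_NormedModule)
      (locally ((fst (T x), snd (T x)) : prod_NormedModule R_AbsRing R_NormedModule R_NormedModule))
      (fun t => (fst t, snd t))).
    { apply filterdiff_linear. split.
      - intros; reflexivity.
      - intros; reflexivity.
      - exists 1. split; [lra|]. intros z. rewrite Rmult_1_l.
        destruct z; apply Rle_refl. }
    generalize (@filterdiff_comp'_2 R_AbsRing R_NormedModule R_NormedModule R_NormedModule C_R_NormedModule
      (fun t => fst (T t)) (fun t => snd (T t)) (fun a b => (a, b)) x _ _ _ H1 H2 Hid).
    intros H. eapply filterdiff_ext_lin.
    + eapply filterdiff_ext; [|exact H]. intros t. symmetry. apply surjective_pairing.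
    + intros y. reflexivity.
Qed.

Lemma derivC_unique (T : R -> C) (x : R) (l m : C) :
  derivC T x l -> derivC T x m -> l = m.
Proof.
  rewrite !derivC_iff. intros [H1 H2] [H3 H4].
  apply is_derive_unique in H1, H2, H3, H4.
  destruct l, m; simpl in *; congruence.
Qed.

Lemma derivC_const (c : C) (x : R) : derivC (fun _ => c) x (RtoC 0).
Proof. exact (@is_derive_const R_AbsRing C_R_NormedModule c x). Qed.

Lemma derivC_RtoC (P : R -> R) (x dP : R) :
  is_derive P x dP -> derivC (fun t => RtoC (P t)) x (RtoC dP).
Proof.
  intros H. apply derivC_iff. split; [exact H|].
  exact (@is_derive_const R_AbsRing R_NormedModule 0 x).
Qed.

Lemma derivC_plus (T S : R -> C) (x : R) (l m : C) :
  derivC T x l -> derivC S x m -> derivC (fun t => T t + S t)%C x (l + m)%C.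
Proof. exact (is_derive_plus (V := C_R_NormedModule) T S x l m). Qed.

Lemma derivC_mult (T S : R -> C) (x : R) (l m : C) :
  derivC T x l -> derivC S x m ->
  derivC (fun t => T t * S t)%C x (l * S x + T x * m)%C.
Proof.
  rewrite !derivC_iff. intros [H1 H2] [H3 H4].
  assert (K : forall (f g h k : R -> R) (df dg dh dk : R),
    is_derive f x df -> is_derive g x dg -> is_derive h x dh -> is_derive k x dk ->
    forall s, is_derive (fun t => f t * g t + s * (h t * k t)) x
      (df * g x + f x * dg + s * (dh * k x + h x * dk))).
  { intros f g h k df dg dh dk Hf Hg Hh Hk s.
    exact (is_derive_plus (V := R_NormedModule) _ _ _ _ _
      (is_derive_mult _ _ _ _ _ Hf Hg Rmult_comm)
      (is_derive_scal _ _ s _ (is_derive_mult _ _ _ _ _ Hh Hk Rmult_comm))). }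
  split.
  - eapply is_derive_ext; [|eapply eq_ind; [exact (K _ _ _ _ _ _ _ _ H1 H3 H2 H4 (-1))|]].
    + intros t; simpl; ring.
    + simpl; ring.
  - eapply is_derive_ext; [|eapply eq_ind; [exact (K _ _ _ _ _ _ _ _ H1 H4 H2 H3 1)|]].
    + intros t; simpl; ring.
    + simpl; ring.
Qed.

Lemma derivC_val (T : R -> C) (x : R) (l m : C) :
  l = m -> derivC T x l -> derivC T x m.
Proof. intros ->; exact (fun h => h). Qed.

Lemma derivC_lin (c d : C) (T S : R -> C) (x : R) (l m : C) :
  derivC T x l -> derivC S x m ->
  derivC (fun t => c * T t + d * S t)%C x (c * l + d * m)%C.
Proof.
  intros H1 H2. eapply derivC_val;
    [|apply derivC_plus; (eapply derivC_mult; [apply derivC_const|eassumption])].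
  cbv beta. ring.
Qed.

Lemma derivC_comp (T : R -> C) (phi : R -> R) (x dphi : R) (l : C) :
  derivC T (phi x) l -> is_derive phi x dphi ->
  derivC (fun t => T (phi t)) x (RtoC dphi * l)%C.
Proof.
  intros H1 H2. generalize (is_derive_comp (V := C_R_NormedModule) T phi x l dphi H1 H2).
  rewrite scal_R_Cmult. exact (fun h => h).
Qed.

Lemma derivC_ext (T S : R -> C) (x r : R) (l : C) :
  0 < r -> (forall t, Rabs (t - x) < r -> T t = S t) ->
  derivC T x l -> derivC S x l.
Proof.
  intros Hr H. apply is_derive_ext_loc.
  exists (mkposreal r Hr). intros t Ht. apply H, Ht.
Qed.

Lemma derivC_0_const (T : R -> C) (lo hi : R) :
  (forall x, lo < x < hi -> derivC T x (RtoC 0)) ->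
  forall x y, lo < x < hi -> lo < y < hi -> T x = T y.
Proof.
  intros H.
  assert (K : forall x y, lo < x < hi -> lo < y < hi -> x < y -> T x = T y).
  { intros x y Hx Hy Hxy.
    apply (eq_is_derive (V := C_R_NormedModule) T x y); [|exact Hxy].
    intros t Ht. apply H. lra. }
  intros x y Hx Hy. destruct (Rtotal_order x y) as [h|[->|h]]; auto.
  symmetry; auto.
Qed.

(** If [T] equals [K] on one side of [e], the difference quotients for the
    increments [h] and [h / 2] are [(K - T e) / h] and its double.  Both tend to
    [D], so [D = 0], and then [T e = K]. *)
Lemma derivC_one_sided_const (T : R -> C) (lo hi e : R) (K D : C) :
  lo < hi -> (e = lo \/ e = hi) ->
  derivC T e D -> (forall x, lo < x < hi -> T x = K) -> T e = K /\ D = RtoC 0.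
Proof.
  intros Hlh He HD HK.
  assert (Real : forall (f : R -> R) (k d : R), is_derive f e d ->
    (forall x, lo < x < hi -> f x = k) -> f e = k /\ d = 0).
  { clear T K D HD HK. intros f k d Hd Hk. apply is_derive_Reals in Hd.
    assert (Step : forall eps, 0 < eps -> Rabs d < 3 * eps /\
               exists h, 0 < Rabs h <= 1 /\ Rabs (k - f e) <= (eps + 3 * eps) * Rabs h).
    { intros eps Heps. destruct (Hd eps Heps) as [delta Hdelta].
      set (h0 := Rmin (Rmin (delta / 2) ((hi - lo) / 2)) 1).
      assert (Hh0 : 0 < h0 /\ h0 < delta /\ h0 < hi - lo /\ h0 <= 1).
      { generalize (cond_pos delta); intros Hp. unfold h0.
        repeat split.
        - repeat apply Rmin_glb_lt; lra.
        - eapply Rle_lt_trans; [eapply Rle_trans; [apply Rmin_l|apply Rmin_l]|lra].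
        - eapply Rle_lt_trans; [eapply Rle_trans; [apply Rmin_l|apply Rmin_r]|lra].
        - apply Rmin_r. }
      destruct Hh0 as (Hp & Hdl & Hw & H1).
      assert (Hh : exists h, h <> 0 /\ Rabs h = h0 /\
                lo < e + h < hi /\ lo < e + h / 2 < hi).
      { destruct He as [->| ->].
        - exists h0. rewrite Rabs_right; lra.
        - exists (- h0). rewrite Rabs_left; lra. }
      destruct Hh as (h & Hn & Ha & Hi1 & Hi2).
      assert (E1 := Hdelta h Hn ltac:(lra)).
      assert (Ha2 : Rabs (h / 2) = h0 / 2).
      { unfold Rdiv. rewrite Rabs_mult, Ha, (Rabs_right (/ 2)); lra. }
      assert (E2 := Hdelta (h / 2) ltac:(lra) ltac:(lra)).
      rewrite Hk in E1 by lra. rewrite Hk in E2 by lra.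
      replace ((k - f e) / (h / 2)) with (2 * ((k - f e) / h)) in E2 by (field; lra).
      assert (Hq : k - f e = ((k - f e) / h) * h) by (field; lra).
      set (q := (k - f e) / h) in *.
      assert (Hd3 : Rabs d < 3 * eps).
      { revert E1 E2. unfold Rabs. repeat destruct Rcase_abs; lra. }
      split; [exact Hd3|].
      exists h. rewrite Ha. split; [lra|].
      rewrite Hq, Rabs_mult, Ha.
      apply Rmult_le_compat_r; [lra|].
      revert E1 Hd3. unfold Rabs. repeat destruct Rcase_abs; lra. }
    split.
    - apply Rminus_diag_uniq_sym.
      destruct (Req_dec (k - f e) 0) as [|Hne]; [assumption|exfalso].
      assert (Hpos := Rabs_pos_lt _ Hne).
      destruct (Step (Rabs (k - f e) / 8)) as (_ & h & Hh & Hb); [lra|].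
      nra.
    - destruct (Req_dec d 0) as [|Hne]; [assumption|exfalso].
      assert (Hpos := Rabs_pos_lt _ Hne).
      destruct (Step (Rabs d / 8)) as (Hb & _); lra. }
  apply derivC_iff in HD. destruct HD as [H1 H2].
  apply Real with (k := fst K) in H1; [|intros x Hx; rewrite HK; auto].
  apply Real with (k := snd K) in H2; [|intros x Hx; rewrite HK; auto].
  destruct H1 as [H1 H3], H2 as [H2 H4]. split.
  - rewrite (surjective_pairing K), <- H1, <- H2. apply surjective_pairing.
  - rewrite (surjective_pairing D), H3, H4. reflexivity.
Qed.

Lemma derivC_glue (F G H : R -> C) (e r : R) (D : C) :
  0 < r ->
  (forall x, e - r < x <= e -> F x = G x) ->
  (forall x, e <= x < e + r -> F x = H x) ->
  derivC G e D -> derivC H e D -> derivC F e D.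
Proof.
  intros Hr HG HH.
  assert (Real : forall (f g h : R -> R) d, 0 < r ->
    (forall x, e - r < x <= e -> f x = g x) ->
    (forall x, e <= x < e + r -> f x = h x) ->
    is_derive g e d -> is_derive h e d -> is_derive f e d).
  { clear. intros f g h d Hp Hg Hh Dg Dh.
    apply is_derive_Reals in Dg. apply is_derive_Reals in Dh. apply is_derive_Reals.
    intros eps Heps. destruct (Dg eps Heps) as [d1 H1], (Dh eps Heps) as [d2 H2].
    assert (Hm : 0 < Rmin r (Rmin d1 d2)).
    { repeat apply Rmin_glb_lt; [lra|apply cond_pos|apply cond_pos]. }
    exists (mkposreal _ Hm). simpl. intros k Hk Hka.
    assert (Hk1 : Rabs k < r /\ Rabs k < d1 /\ Rabs k < d2).
    { repeat split; eapply Rlt_le_trans; try exact Hka.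
      - apply Rmin_l.
      - eapply Rle_trans; [apply Rmin_r|apply Rmin_l].
      - eapply Rle_trans; [apply Rmin_r|apply Rmin_r]. }
    destruct Hk1 as (K1 & K2 & K3). apply Rabs_def2 in K1.
    destruct (Rle_dec k 0).
    - rewrite !Hg by lra. now apply H1.
    - rewrite !Hh by lra. now apply H2. }
  rewrite !derivC_iff. intros [G1 G2] [H1 H2]. split.
  - eapply Real; [exact Hr| | |exact G1|exact H1]; intros; simpl; f_equal; auto.
  - eapply Real; [exact Hr| | |exact G2|exact H2]; intros; simpl; f_equal; auto.
Qed.

(** * Second-order linear equations *)

Lemma solves_ext (p q : R -> C) (lo hi : Rbar) (T S : R -> C) :
  (forall x : R, Rbar_lt lo x -> Rbar_lt x hi -> T x = S x) ->
  solves_linear_ode p q lo hi T -> solves_linear_ode p q lo hi S.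
Proof.
  intros E (dT & ddT & H). exists dT, ddT. intros x H1 H2.
  destruct (H x H1 H2) as (A1 & A2 & A3). refine (conj _ (conj _ _)); [|exact A2|rewrite <- E; auto].
  apply (is_derive_ext_loc (V := C_R_NormedModule) T); [|exact A1].
  apply (locally_interval _ x lo hi H1 H2). auto.
Qed.

Lemma solves_sub (p q : R -> C) (lo hi lo' hi' : Rbar) (T : R -> C) :
  Rbar_le lo lo' -> Rbar_le hi' hi ->
  solves_linear_ode p q lo hi T -> solves_linear_ode p q lo' hi' T.
Proof.
  intros H1 H2 (dT & ddT & H). exists dT, ddT. intros x h1 h2.
  apply H; [exact (Rbar_le_lt_trans _ _ _ H1 h1)|exact (Rbar_lt_le_trans _ _ _ h2 H2)].
Qed.

Lemma solves_lin (p q : R -> C) (lo hi : Rbar) (c d : C) (T S : R -> C) :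
  solves_linear_ode p q lo hi T -> solves_linear_ode p q lo hi S ->
  solves_linear_ode p q lo hi (fun x => c * T x + d * S x)%C.
Proof.
  intros (dT & ddT & H) (dS & ddS & K).
  exists (fun x => c * dT x + d * dS x)%C, (fun x => c * ddT x + d * ddS x)%C.
  intros x h1 h2. destruct (H x h1 h2) as (A1 & A2 & A3), (K x h1 h2) as (B1 & B2 & B3).
  refine (conj _ (conj _ _)); [now apply derivC_lin|now apply derivC_lin|].
  transitivity (c * (ddT x + p x * dT x + q x * T x) + d * (ddS x + p x * dS x + q x * S x))%C.
  - ring.
  - rewrite A3, B3. ring.
Qed.

Lemma solves_zero (p q : R -> C) (lo hi : Rbar) :
  solves_linear_ode p q lo hi (fun _ => RtoC 0).
Proof.
  exists (fun _ => RtoC 0), (fun _ => RtoC 0). intros x _ _.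
  refine (conj _ (conj _ _)); [apply derivC_const|apply derivC_const|ring].
Qed.

(** By the chain rule the new operator applied to [T o phi] is [phi' ^ 2] times
    the old one applied to [T], provided that the coefficients satisfy these two
    identities. *)
Lemma solves_change_var (p q p' q' : R -> C) (phi dphi ddphi : R -> R)
    (lo hi lo' hi' : Rbar) (T : R -> C) :
  (forall x : R, Rbar_lt lo' x -> Rbar_lt x hi' ->
     (Rbar_lt lo (phi x) /\ Rbar_lt (phi x) hi) /\
     is_derive phi x (dphi x) /\ is_derive dphi x (ddphi x) /\
     (RtoC (ddphi x) + p' x * RtoC (dphi x) = p (phi x) * RtoC (dphi x) ^ 2)%C /\
     (q' x = q (phi x) * RtoC (dphi x) ^ 2)%C) ->
  solves_linear_ode p q lo hi T ->
  solves_linear_ode p' q' lo' hi' (fun x => T (phi x)).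
Proof.
  intros Hphi (dT & ddT & H).
  exists (fun x => RtoC (dphi x) * dT (phi x))%C,
    (fun x => RtoC (ddphi x) * dT (phi x) + RtoC (dphi x) * (RtoC (dphi x) * ddT (phi x)))%C.
  intros x h1 h2. destruct (Hphi x h1 h2) as ((A1 & A2) & A3 & A4 & A5 & A6).
  destruct (H _ A1 A2) as (B1 & B2 & B3). refine (conj _ (conj _ _)).
  - now apply derivC_comp.
  - apply (derivC_mult (fun x => RtoC (dphi x)) (fun x => dT (phi x))).
    + now apply derivC_RtoC.
    + now apply derivC_comp.
  - rewrite A6.
    transitivity ((RtoC (ddphi x) + p' x * RtoC (dphi x)) * dT (phi x) +
      RtoC (dphi x) ^ 2 * (ddT (phi x) + q (phi x) * T (phi x)))%C; [simpl; ring|].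
    rewrite A5.
    transitivity (RtoC (dphi x) ^ 2 * (ddT (phi x) + p (phi x) * dT (phi x) + q (phi x) * T (phi x)))%C;
      [simpl; ring|]. rewrite B3. ring.
Qed.

(** The derivatives that witness local solutions are arbitrary outside their
    intervals; [Derive] on each component is a single choice that agrees with all
    of them. *)
Lemma solves_local (p q : R -> C) (lo hi : Rbar) (T : R -> C) :
  (forall x : R, Rbar_lt lo x -> Rbar_lt x hi ->
     exists r, 0 < r /\ solves_linear_ode p q (x - r) (x + r) T) ->
  solves_linear_ode p q lo hi T.
Proof.
  intros H.
  set (D := fun (F : R -> C) x => (Derive (fun t => fst (F t)) x, Derive (fun t => snd (F t)) x) : C).
  assert (HD : forall F x l, derivC F x l -> D F x = l).
  { intros F x l HF. apply derivC_iff in HF. destruct HF as [H1 H2].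
    rewrite (surjective_pairing l). unfold D. f_equal; now apply is_derive_unique. }
  exists (D T), (D (D T)). intros x h1 h2.
  destruct (H x h1 h2) as (r & Hr & dT & ddT & K).
  assert (E : forall t, Rabs (t - x) < r -> dT t = D T t).
  { intros t Ht. apply Rabs_def2 in Ht. destruct (K t) as (K1 & _); simpl; try lra.
    symmetry. now apply HD. }
  destruct (K x) as (K1 & K2 & K3); simpl; try lra.
  assert (K4 : derivC (D T) x (ddT x)) by now apply (derivC_ext dT _ x r).
  rewrite (HD _ _ _ K4), (HD _ _ _ K1). auto.
Qed.

(** Gronwall: [exp (- L x) E] decreases and [exp (L x) E] increases, and [E] is
    nonnegative, so a zero of [E] spreads in both directions. *)
Lemma gronwall_zero (E dE : R -> R) (lo hi L x0 : R) :
  (forall x, lo < x < hi -> is_derive E x (dE x)) ->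
  (forall x, lo < x < hi -> 0 <= E x /\ Rabs (dE x) <= L * E x) ->
  lo < x0 < hi -> E x0 = 0 -> forall x, lo < x < hi -> E x = 0.
Proof.
  intros HE HL Hx0 E0.
  assert (HG : forall k x, lo < x < hi ->
    is_derive (fun t => exp (k * t) * E t) x (exp (k * x) * (k * E x + dE x))).
  { intros k x Hx. 
    assert (H1 : is_derive (fun t => exp (k * t)) x (k * exp (k * x))) by (auto_derive; [easy|ring]).
    generalize (is_derive_mult _ _ _ _ _ H1 (HE x Hx) Rmult_comm).
    intros H. eapply eq_ind; [exact H|]. simpl. unfold plus, mult; simpl. ring. }
  assert (Hmvt : forall k x y, lo < x < hi -> lo < y < hi -> exists c, Rmin x y <= c <= Rmax x y /\
      exp (k * y) * E y - exp (k * x) * E x = exp (k * c) * (k * E c + dE c) * (y - x)).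
  { intros k x y Hx Hy.
    assert (In : forall t, Rmin x y <= t <= Rmax x y -> lo < t < hi).
    { intros t. unfold Rmin, Rmax. destruct Rle_dec; lra. }
    apply (MVT_gen (fun t => exp (k * t) * E t) x y (fun t => exp (k * t) * (k * E t + dE t))).
    - intros t Ht. apply HG, In. lra.
    - intros t Ht. apply continuity_pt_filterlim.
      refine (ex_derive_continuous (V := R_NormedModule) (fun t => exp (k * t) * E t) t _).
      eexists. apply HG, In, Ht. }
  intros x Hx. apply Rle_antisym; [|apply HL, Hx].
  destruct (Rle_dec x0 x) as [h|h].
  - destruct (Hmvt (- L) x0 x Hx0 Hx) as (c & Hc & Heq).
    rewrite E0, Rmult_0_r, Rminus_0_r in Heq.
    rewrite Rmin_left, Rmax_right in Hc by lra.
    destruct (HL c) as [H1 H2]; [lra|].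
    assert (Hd : - L * E c + dE c <= 0) by (apply Rabs_le_between in H2; lra).
    assert (P1 := exp_pos (- L * c)). assert (P2 := exp_pos (- L * x)).
    assert (exp (- L * c) * (- L * E c + dE c) * (x - x0) <= 0).
    { assert (0 <= exp (- L * c) * - (- L * E c + dE c)) by (apply Rmult_le_pos; lra). nra. }
    nra.
  - destruct (Hmvt L x x0 Hx Hx0) as (c & Hc & Heq).
    rewrite E0, Rmult_0_r in Heq.
    rewrite Rmin_left, Rmax_right in Hc by lra.
    destruct (HL c) as [H1 H2]; [lra|].
    assert (Hd : 0 <= L * E c + dE c) by (apply Rabs_le_between in H2; lra).
    assert (P1 := exp_pos (L * c)). assert (P2 := exp_pos (L * x)).
    assert (0 <= exp (L * c) * (L * E c + dE c) * (x0 - x)).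
    { apply Rmult_le_pos; [apply Rmult_le_pos|]; lra. }
    nra.
Qed.

(** The energy [|T|^2 + |T'|^2] has derivative at most [(1 + 3 K)] times itself
    in absolute value, and it vanishes inside the interval where [T] does. *)
Lemma solves_unique (p q : R -> C) (K lo hi c d : R) (T : R -> C) :
  (forall x, lo < x < hi -> Cmod (p x) <= K /\ Cmod (q x) <= K) ->
  solves_linear_ode p q lo hi T ->
  lo <= c -> c < d -> d <= hi -> (forall x, c < x < d -> T x = RtoC 0) ->
  forall x, lo < x < hi -> T x = RtoC 0.
Proof.
  intros HK (dT & ddT & H) Hlc Hcd Hdh HT0.
  set (x0 := (c + d) / 2).
  assert (T0 : T x0 = RtoC 0) by (apply HT0; unfold x0; lra).
  assert (D0 : dT x0 = RtoC 0).
  { destruct (H x0) as (H1 & _); [unfold x0; simpl; lra..|].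
    apply (derivC_unique T x0); [exact H1|].
    apply (derivC_ext (fun _ => RtoC 0) T x0 ((d - c) / 2)); [lra| |apply derivC_const].
    intros t Ht. apply Rabs_def2 in Ht. symmetry. apply HT0. unfold x0 in Ht. lra. }
  set (nsq := fun z : C => fst z * fst z + snd z * snd z).
  set (ip := fun z w : C => fst z * fst w + snd z * snd w).
  set (E := fun x => nsq (T x) + nsq (dT x)).
  assert (Hn : forall F x l, derivC F x l -> is_derive (fun t => nsq (F t)) x (2 * ip (F x) l)).
  { intros F x l HF. apply derivC_iff in HF. destruct HF as [H1 H2].
    eapply eq_ind; [exact (is_derive_plus (V := R_NormedModule) _ _ _ _ _
      (is_derive_mult _ _ _ _ _ H1 H1 Rmult_comm) (is_derive_mult _ _ _ _ _ H2 H2 Rmult_comm))|].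
    unfold plus, mult, ip; simpl. ring. }
  assert (Hmod : forall z, nsq z = Cmod z ^ 2).
  { intros z. unfold Cmod, nsq. rewrite pow2_sqrt; [ring|]. nra. }
  assert (Hip : forall z w, Rabs (ip z w) <= Cmod z * Cmod w).
  { intros z w. apply Rabs_le_between.
    assert (ip z w ^ 2 <= (Cmod z * Cmod w) ^ 2).
    { rewrite Rpow_mult_distr, <- !Hmod. unfold ip, nsq.
      assert (0 <= (fst z * snd w - snd z * fst w) ^ 2) by apply pow2_ge_0. nra. }
    assert (0 <= Cmod z * Cmod w) by (apply Rmult_le_pos; apply Cmod_ge_0). nra. }
  assert (HE : forall x, lo < x < hi -> E x = 0).
  { apply (gronwall_zero E (fun x => 2 * ip (T x) (dT x) + 2 * ip (dT x) (ddT x))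
             lo hi (1 + 3 * K) x0).
    - intros x Hx. destruct (H x) as (H1 & H2 & _); simpl; try lra.
      exact (is_derive_plus (V := R_NormedModule) _ _ _ _ _ (Hn _ _ _ H1) (Hn _ _ _ H2)).
    - intros x Hx. destruct (H x) as (_ & _ & H3); simpl; try lra.
      destruct (HK x Hx) as [Kp Kq]. unfold E. rewrite !Hmod.
      assert (P1 := Cmod_ge_0 (T x)). assert (P2 := Cmod_ge_0 (dT x)).
      assert (P3 := Cmod_ge_0 (p x)).
      split; [nra|].
      assert (Hdd : Cmod (ddT x) <= K * Cmod (dT x) + K * Cmod (T x)).
      { replace (ddT x) with (- (p x * dT x + q x * T x))%C.
        - rewrite Cmod_opp. eapply Rle_trans; [apply Cmod_triangle|].
          rewrite !Cmod_mult. apply Rplus_le_compat; apply Rmult_le_compat_r; auto.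
        - rewrite <- (Cplus_0_l (- _)), <- H3. ring. }
      eapply Rle_trans; [apply Rabs_triang|].
      rewrite !Rabs_mult, (Rabs_right 2) by lra.
      assert (I1 := Hip (T x) (dT x)). assert (I2 := Hip (dT x) (ddT x)).
      assert (Cmod (dT x) * Cmod (ddT x) <= Cmod (dT x) * (K * Cmod (dT x) + K * Cmod (T x)))
        by (apply Rmult_le_compat_l; auto).
      assert (0 <= (Cmod (T x) - Cmod (dT x)) ^ 2) by apply pow2_ge_0.
      assert (0 <= K * (Cmod (T x) - Cmod (dT x)) ^ 2) by (apply Rmult_le_pos; [lra|auto]).
      assert (0 <= K * Cmod (T x) ^ 2) by (apply Rmult_le_pos; [lra|apply pow2_ge_0]).
      nra.
    - unfold x0; lra.
    - unfold E. rewrite T0, D0. unfold nsq; simpl; ring. }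
  intros x Hx. specialize (HE x Hx). unfold E in HE. rewrite !Hmod in HE.
  apply Cmod_eq_0. assert (P2 := pow2_ge_0 (Cmod (dT x))). assert (P1 := Cmod_ge_0 (T x)). nra.
Qed.

(** Differentiability of [k] serves here as a convenient form of continuity. *)
Lemma antiderivative (k : R -> C) (lo hi : R) :
  lo < hi ->
  (forall x, lo < x < hi -> exists l, derivC k x l) ->
  exists H : R -> C, forall x, lo < x < hi -> derivC H x (k x).
Proof.
  intros Hlh Hk.
  assert (Hc : forall x, lo < x < hi -> continuous (U := C_R_NormedModule) k x).
  { intros x Hx. apply (ex_derive_continuous (K := R_AbsRing) (V := C_R_NormedModule)).
    apply Hk, Hx. }
  set (e := (lo + hi) / 2).
  exists (fun x => RInt (V := C_R_CompleteNormedModule) k e x). intros x Hx.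
  apply (is_derive_RInt (V := C_R_NormedModule) k _ e x); [|now apply Hc].
  apply (locally_interval _ x lo hi); simpl; try lra.
  intros y Hy1 Hy2. simpl in *.
  apply (RInt_correct (V := C_R_CompleteNormedModule)).
  apply (ex_RInt_continuous (V := C_R_CompleteNormedModule)).
  intros z Hz. apply Hc. revert Hz. unfold Rmin, Rmax, e. destruct Rle_dec; lra.
Qed.

(** With the integrating factor [P], the equation reads [(P F')' = - P q F].  The
    right-hand side is continuous across [e], so it has a primitive [H] there, and
    [P F' - H] is constant on each side.  Each constant is fixed by the one-sided
    derivative of [F] at [e], which is [D] on both sides; hence [P F' - H] is a
    single constant, and [F'] is differentiable at [e]. *)
Lemma removable (P p : R -> R) (q : R -> C) (e r : R) (F : R -> C) (D : C) :
  0 < r ->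
  (forall x, 0 < P x /\ is_derive P x (p x * P x)) ->
  (forall x, exists l, derivC q x l) ->
  solves_linear_ode (fun x => RtoC (p x)) q (e - r) e F ->
  solves_linear_ode (fun x => RtoC (p x)) q e (e + r) F ->
  derivC F e D ->
  solves_linear_ode (fun x => RtoC (p x)) q (e - r) (e + r) F.
Proof.
  intros Hr HP Hq SL SR HD.
  assert (HF : forall x, e - r < x < e + r -> exists l, derivC F x l).
  { intros x Hx. destruct (Rtotal_order x e) as [h|[->|h]].
    - destruct SL as (dT & ? & H). exists (dT x). apply H; simpl; lra.
    - now exists D.
    - destruct SR as (dT & ? & H). exists (dT x). apply H; simpl; lra. }
  set (k := fun x => (- RtoC 1 * (RtoC (P x) * (q x * F x)))%C).
  destruct (antiderivative k (e - r) (e + r)) as [H HH]; [lra| |].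
  { intros x Hx. destruct (HF x Hx) as [l Hl], (Hq x) as [m Hm], (HP x) as [_ HPx].
    eexists. eapply derivC_mult; [apply derivC_const|].
    eapply derivC_mult; [exact (derivC_RtoC _ _ _ HPx)|].
    eapply derivC_mult; eassumption. }
  assert (HiP : forall x, is_derive (fun t => / P t) x (- p x / P x)).
  { intros x. destruct (HP x) as [P0 HPx].
    eapply eq_ind; [apply (is_derive_inv P x _ HPx); lra|]. simpl. field. lra. }
  set (c := (RtoC (P e) * D - H e)%C).
  (* [F'] as the conserved quantity [P F' - H = c] dictates it; it makes sense
     at [e] as well. *)
  set (Gof := fun c x => (RtoC (/ P x) * (H x + c))%C).
  assert (HG : forall c x, e - r < x < e + r ->
     derivC (Gof c) x (- RtoC (p x) * Gof c x - q x * F x)%C).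
  { intros c' x Hx. destruct (HP x) as [P0 _].
    eapply derivC_val; [|eapply (derivC_mult (fun x => RtoC (/ P x)) (fun x => H x + c')%C);
      [exact (derivC_RtoC _ _ _ (HiP x))|
       apply derivC_plus; [apply HH, Hx|apply derivC_const]]].
    unfold Gof, k. 
    replace (RtoC (- p x / P x)) with (- RtoC (p x) * RtoC (/ P x))%C
      by (rewrite <- RtoC_opp, <- RtoC_mult; f_equal).
    transitivity (- RtoC (p x) * (RtoC (/ P x) * (H x + c')) - (RtoC (/ P x) * RtoC (P x)) * (q x * F x))%C;
      [ring|].
    rewrite <- RtoC_mult, Rinv_l by lra. ring. }
  assert (Side : forall lo hi, e - r <= lo -> hi <= e + r -> lo < hi -> e = lo \/ e = hi ->
    solves_linear_ode (fun x => RtoC (p x)) q lo hi F ->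
    forall x, lo < x < hi -> derivC F x (Gof c x)).
  { intros lo hi Hlo Hhi Hlh He (dT & ddT & Hs).
    assert (Hdc : forall x, lo < x < hi -> derivC (fun t => RtoC (P t) * dT t + - RtoC 1 * H t)%C x (RtoC 0)).
    { intros x Hx. destruct (Hs x) as (A1 & A2 & A3); simpl; try lra.
      destruct (HP x) as [P0 HPx].
      eapply derivC_val; [|apply derivC_plus; [eapply derivC_mult; [exact (derivC_RtoC _ _ _ HPx)|exact A2]|
        eapply derivC_mult; [apply derivC_const|apply HH; lra]]].
      unfold k. rewrite RtoC_mult.
      transitivity (RtoC (P x) * (ddT x + RtoC (p x) * dT x + q x * F x))%C; [ring|rewrite A3; ring]. }
    set (m := (lo + hi) / 2).
    set (c' := (RtoC (P m) * dT m + - RtoC 1 * H m)%C).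
    assert (EdT : forall x, lo < x < hi -> dT x = Gof c' x).
    { intros x Hx. unfold Gof, c'.
      assert (Hm : lo < m < hi) by (unfold m; lra).
      rewrite <- (derivC_0_const _ lo hi Hdc x m Hx Hm).
      transitivity ((RtoC (/ P x) * RtoC (P x)) * dT x)%C; [|ring].
      destruct (HP x). rewrite <- RtoC_mult, Rinv_l by lra. ring. }
    destruct (antiderivative (Gof c') (e - r) (e + r)) as [Phi HPhi]; [lra| |].
    { intros x Hx. eexists. apply HG, Hx. }
    assert (He' : e - r < e < e + r) by lra.
    assert (Hconst : derivC (fun t => F t + - RtoC 1 * Phi t)%C e (D + (RtoC 0 * Phi e + - RtoC 1 * Gof c' e))%C).
    { apply derivC_plus; [exact HD|]. apply derivC_mult; [apply derivC_const|apply HPhi, He']. }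
    destruct (derivC_one_sided_const _ lo hi e (F m + - RtoC 1 * Phi m)%C _ Hlh He Hconst) as [_ Hval].
    { intros x Hx. apply (derivC_0_const (fun t => F t + - RtoC 1 * Phi t)%C lo hi); [|exact Hx|unfold m; lra].
      intros t Ht. destruct (Hs t) as (A1 & _); simpl; try lra.
      eapply derivC_val; [|apply derivC_plus; [exact A1|apply derivC_mult; [apply derivC_const|apply HPhi; lra]]].
      rewrite EdT by exact Ht. ring. }
    (* [F] minus a primitive of its extended derivative is constant on this side
       and differentiable at [e], so [F] has there the derivative [Gof c' e]. *)
    assert (Ec : c' = c).
    { assert (HDe : D = Gof c' e).
      { rewrite <- (Cplus_0_l (Gof c' e)), <- Hval. ring. }
      unfold c. rewrite HDe. unfold Gof.
      transitivity ((RtoC (P e) * RtoC (/ P e)) * (H e + c') - H e)%C; [|ring].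
      destruct (HP e). rewrite <- RtoC_mult, Rinv_r by lra. ring. }
    intros x Hx. rewrite <- Ec, <- EdT by exact Hx. apply Hs; simpl; lra. }
  exists (Gof c), (fun x => - RtoC (p x) * Gof c x - q x * F x)%C.
  intros x h1 h2. simpl in h1, h2. refine (conj _ (conj _ _)); [|now apply HG|ring].
  destruct (Rtotal_order x e) as [h|[->|h]].
  - apply (Side (e - r) e); auto; lra.
  - eapply derivC_val; [|exact HD]. unfold Gof, c.
    transitivity ((RtoC (/ P e) * RtoC (P e)) * D)%C; [|ring].
    destruct (HP e). rewrite <- RtoC_mult, Rinv_l by lra. ring.
  - apply (Side e (e + r)); auto; lra.
Qed.

(** * The Lamé equation on an interval *)

Lemma RtoC_m1 : RtoC (-1) = (- RtoC 1)%C.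
Proof. apply injective_projections; simpl; ring. Qed.

Definition lame_p (x : R) : R := cos x * sin x / (2 - cos x ^ 2).

Definition lame_q (nu c : C) (x : R) : C :=
  (nu * (nu + 1) * RtoC (sin x ^ 2 / (2 - cos x ^ 2)) + c / RtoC (2 - cos x ^ 2))%C.

Notation solves_lame_on nu c := (solves_linear_ode (fun x => RtoC (lame_p x)) (lame_q nu c)).

Lemma lame_den_bounds (x : R) : 1 <= 2 - cos x ^ 2 <= 2.
Proof.
  assert (H := sin2_cos2 x). unfold Rsqr in H.
  assert (0 <= sin x * sin x) by nra. assert (0 <= cos x * cos x) by nra. simpl. lra.
Qed.

Lemma lame_bounded (nu c : C) (x : R) :
  Cmod (RtoC (lame_p x)) <= 1 + Cmod (nu * (nu + 1)) + Cmod c /\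
  Cmod (lame_q nu c x) <= 1 + Cmod (nu * (nu + 1)) + Cmod c.
Proof.
  destruct (lame_den_bounds x) as [D1 D2]. assert (H := sin2_cos2 x). unfold Rsqr in H.
  assert (N1 := Cmod_ge_0 (nu * (nu + 1))). assert (N2 := Cmod_ge_0 c).
  assert (Hi : / (2 - cos x ^ 2) <= 1) by (rewrite <- Rinv_1; apply Rinv_le_contravar; lra).
  assert (Hi0 : 0 < / (2 - cos x ^ 2)) by (apply Rinv_0_lt_compat; lra).
  assert (Hprod : forall y, Rabs y <= 1 -> Rabs (y / (2 - cos x ^ 2)) <= 1).
  { intros y Hy. unfold Rdiv. rewrite Rabs_mult, (Rabs_right (/ _)) by lra.
    assert (P := Rabs_pos y). nra. }
  split.
  - rewrite Cmod_R. assert (Rabs (lame_p x) <= 1); [|lra].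
    apply Hprod, Rabs_le_between.
    assert (0 <= (cos x - sin x) ^ 2) by apply pow2_ge_0.
    assert (0 <= (cos x + sin x) ^ 2) by apply pow2_ge_0. nra.
  - unfold lame_q. eapply Rle_trans; [apply Cmod_triangle|].
    rewrite (Cmod_mult (nu * (nu + 1))), Cmod_R.
    assert (Hd : Cmod (c / RtoC (2 - cos x ^ 2)) <= Cmod c).
    { unfold Cdiv. rewrite Cmod_mult, <- RtoC_inv, Cmod_R, Rabs_right by lra. nra. }
    assert (Rabs (sin x ^ 2 / (2 - cos x ^ 2)) <= 1).
    { apply Hprod, Rabs_le_between. nra. }
    assert (Cmod (nu * (nu + 1)) * Rabs (sin x ^ 2 / (2 - cos x ^ 2)) <= Cmod (nu * (nu + 1)))
      by nra.
    lra.
Qed.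

Lemma lame_unique (nu c : C) (lo hi x1 x2 : R) (T : R -> C) :
  solves_lame_on nu c lo hi T ->
  lo <= x1 -> x1 < x2 -> x2 <= hi -> (forall x, x1 < x < x2 -> T x = RtoC 0) ->
  forall x, lo < x < hi -> T x = RtoC 0.
Proof.
  apply solves_unique with (K := 1 + Cmod (nu * (nu + 1)) + Cmod c).
  intros x _. apply lame_bounded.
Qed.

Lemma lame_agree (nu c : C) (lo hi x1 x2 : R) (T S : R -> C) :
  solves_lame_on nu c lo hi T -> solves_lame_on nu c lo hi S ->
  lo <= x1 -> x1 < x2 -> x2 <= hi -> (forall x, x1 < x < x2 -> T x = S x) ->
  forall x, lo < x < hi -> T x = S x.
Proof.
  intros HT HS H1 H2 H3 H x Hx.
  assert (E : (RtoC 1 * T x + - RtoC 1 * S x)%C = RtoC 0).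
  { apply (lame_unique nu c lo hi x1 x2 (fun x => RtoC 1 * T x + - RtoC 1 * S x)%C); auto.
    - now apply solves_lin.
    - intros y Hy. rewrite H by exact Hy. ring. }
  transitivity ((RtoC 1 * T x + - RtoC 1 * S x) + S x)%C; [ring|rewrite E; ring].
Qed.

(** [sqrt (2 - cos x ^ 2)] is the integrating factor of the Lamé equation. *)
Lemma lame_removable (nu c : C) (e r : R) (F : R -> C) (D : C) :
  0 < r ->
  solves_lame_on nu c (e - r) e F ->
  solves_lame_on nu c e (e + r) F ->
  derivC F e D ->
  solves_lame_on nu c (e - r) (e + r) F.
Proof.
  intros Hr. apply (removable (fun x => sqrt (2 - cos x ^ 2)) lame_p); [exact Hr| |].
  - intros x. destruct (lame_den_bounds x) as [D1 D2].
    assert (P := sqrt_lt_R0 (2 - cos x ^ 2) ltac:(lra)). split; [exact P|].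
    auto_derive; [simpl in *; lra|]. unfold lame_p.
    assert (E := sqrt_sqrt (2 - cos x ^ 2) ltac:(lra)).
    replace (2 + - (cos x * (cos x * 1))) with (2 - cos x ^ 2) by (simpl; ring).
    set (s := sqrt (2 - cos x ^ 2)) in *. rewrite <- E. field. lra.
  - intros x. destruct (lame_den_bounds x) as [D1 D2]. eexists. unfold lame_q.
    apply (derivC_plus (fun x => nu * (nu + 1) * RtoC (sin x ^ 2 / (2 - cos x ^ 2)))%C
                       (fun x => c / RtoC (2 - cos x ^ 2))%C).
    + apply (derivC_mult (fun _ => nu * (nu + 1))%C); [apply derivC_const|].
      apply derivC_RtoC. auto_derive; [simpl in *; lra|reflexivity].
    + apply (derivC_mult (fun _ => c) (fun x => / RtoC (2 - cos x ^ 2))%C); [apply derivC_const|].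
      apply (derivC_ext (fun x => RtoC (/ (2 - cos x ^ 2))) _ x 1); [lra| |].
      * intros t _. apply RtoC_inv. destruct (lame_den_bounds t); lra.
      * apply derivC_RtoC. auto_derive; [simpl in *; lra|reflexivity].
Qed.

(** An affine isometry that preserves [cos ^ 2] and multiplies [cos * sin] by its
    slope preserves the equation; this covers the reflections in the multiples of
    [PI / 2] and the translations by multiples of [PI]. *)
Lemma lame_affine (nu c : C) (m s : R) (lo hi lo' hi' : Rbar) (T : R -> C) :
  s ^ 2 = 1 ->
  (forall x, cos (m + s * x) ^ 2 = cos x ^ 2) ->
  (forall x, cos (m + s * x) * sin (m + s * x) = s * (cos x * sin x)) ->
  (forall x : R, Rbar_lt lo' x -> Rbar_lt x hi' ->
     Rbar_lt lo (m + s * x) /\ Rbar_lt (m + s * x) hi) ->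
  solves_lame_on nu c lo hi T ->
  solves_lame_on nu c lo' hi' (fun x => T (m + s * x)).
Proof.
  intros Hs Hc Hcs Hr. apply (solves_change_var _ _ _ _ (fun x => m + s * x) (fun _ => s) (fun _ => 0)).
  intros x h1 h2. refine (conj (Hr x h1 h2) (conj _ (conj _ (conj _ _)))).
  - auto_derive; [easy|ring].
  - apply (@is_derive_const R_AbsRing R_NormedModule).
  - unfold lame_p. rewrite Hc, Hcs, <- RtoC_pow, Hs, <- !RtoC_mult, <- RtoC_plus.
    f_equal. unfold Rdiv. ring.
  - unfold lame_q. rewrite Hc, <- RtoC_pow, Hs.
    replace (sin (m + s * x) ^ 2) with (sin x ^ 2); [ring|].
    generalize (sin2_cos2 x) (sin2_cos2 (m + s * x)) (Hc x). unfold Rsqr. simpl. lra.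
Qed.

Lemma sin_PI_sub x : sin (PI + -1 * x) = sin x.
Proof. replace (PI + -1 * x) with (PI - x) by ring. apply sin_PI_x. Qed.

Lemma cos_PI_sub x : cos (PI + -1 * x) = - cos x.
Proof.
  replace (PI + -1 * x) with (- (x + - PI)) by ring.
  rewrite cos_neg, cos_plus, cos_neg, sin_neg, cos_PI, sin_PI. ring.
Qed.

Lemma cos_2PI_sub x : cos (2 * PI - x) = cos x.
Proof.
  replace (2 * PI - x) with (- x + 2 * PI) by ring.
  rewrite cos_plus, cos_2PI, sin_2PI, cos_neg. ring.
Qed.

Lemma lame_reflect_PI (nu c : C) (lo hi : R) (T : R -> C) :
  solves_lame_on nu c lo hi T ->
  solves_lame_on nu c (PI - hi) (PI - lo) (fun x => T (PI - x)).
Proof.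
  intros H. eapply solves_ext; [|apply (lame_affine nu c PI (-1) lo hi _ _ T)].
  - intros x _ _. cbv beta. f_equal. ring.
  - ring.
  - intros x. rewrite cos_PI_sub. ring.
  - intros x. rewrite cos_PI_sub, sin_PI_sub. ring.
  - intros x; simpl; lra.
  - exact H.
Qed.

Lemma lame_reflect_0 (nu c : C) (lo hi : R) (T : R -> C) :
  solves_lame_on nu c lo hi T ->
  solves_lame_on nu c (- hi) (- lo) (fun x => T (- x)).
Proof.
  intros H. eapply solves_ext; [|apply (lame_affine nu c 0 (-1) lo hi _ _ T)].
  - intros x _ _. cbv beta. f_equal. ring.
  - ring.
  - intros x. replace (0 + -1 * x) with (- x) by ring. now rewrite cos_neg.
  - intros x. replace (0 + -1 * x) with (- x) by ring. rewrite cos_neg, sin_neg. ring.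
  - intros x; simpl; lra.
  - exact H.
Qed.

Lemma lame_shift_2PI (nu c : C) (lo hi : R) (T : R -> C) :
  solves_lame_on nu c lo hi T ->
  solves_lame_on nu c (lo - 2 * PI) (hi - 2 * PI) (fun x => T (x + 2 * PI)).
Proof.
  intros H. eapply solves_ext; [|apply (lame_affine nu c (2 * PI) 1 lo hi _ _ T)].
  - intros x _ _. cbv beta. f_equal. ring.
  - ring.
  - intros x. replace (2 * PI + 1 * x) with (x + 2 * PI) by ring.
    rewrite cos_plus, cos_2PI, sin_2PI. ring.
  - intros x. replace (2 * PI + 1 * x) with (x + 2 * PI) by ring.
    rewrite cos_plus, sin_plus, cos_2PI, sin_2PI. ring.
  - intros x; simpl; lra.
  - exact H.
Qed.

Lemma lame_scal (nu c : C) (lo hi : Rbar) (m : C) (T : R -> C) :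
  solves_lame_on nu c lo hi T -> solves_lame_on nu c lo hi (fun x => m * T x)%C.
Proof.
  intros H. eapply solves_ext; [|exact (solves_lin _ _ _ _ m (RtoC 0) _ _ H H)].
  intros x _ _. cbv beta. ring.
Qed.

(** * One-sided Cauchy data and parity *)

(** Value and derivative at 0 from the right, carried by a function
    differentiable at 0 that agrees with [h] on the right.  In this form the
    chain rule applies at the end point, whatever the values of [h] at 0 and to
    the left are. *)
Definition right_jet (h : R -> C) (A L : C) : Prop :=
  exists (H : R -> C) (r : R),
    0 < r /\ derivC H 0 L /\ H 0 = A /\ forall s, 0 < s < r -> h s = H s.

Lemma right_jet_unique (h : R -> C) (A L A' L' : C) :
  right_jet h A L -> right_jet h A' L' -> A = A' /\ L = L'.
Proof.
  intros (H & r & Hr & HL & HA & HE) (H' & r' & Hr' & HL' & HA' & HE').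
  assert (D := derivC_lin (RtoC 1) (- RtoC 1) _ _ _ _ _ HL HL').
  assert (Hm : 0 < Rmin r r') by (apply Rmin_glb_lt; lra).
  destruct (derivC_one_sided_const _ 0 (Rmin r r') 0 (RtoC 0) _ Hm (or_introl eq_refl) D) as [E1 E2].
  { intros x Hx. assert (M1 := Rmin_l r r'). assert (M2 := Rmin_r r r').
    rewrite <- HE, <- HE' by lra. ring. }
  rewrite HA, HA' in E1. split.
  - transitivity ((RtoC 1 * A + - RtoC 1 * A') + A')%C; [ring|rewrite E1; ring].
  - transitivity ((RtoC 1 * L + - RtoC 1 * L') + L')%C; [ring|rewrite E2; ring].
Qed.

Lemma right_jet_lin (c d : C) (h k : R -> C) (A L B M : C) :
  right_jet h A L -> right_jet k B M ->
  right_jet (fun s => c * h s + d * k s)%C (c * A + d * B)%C (c * L + d * M)%C.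
Proof.
  intros (H & r & Hr & HL & HA & HE) (H' & r' & Hr' & HL' & HA' & HE').
  exists (fun s => c * H s + d * H' s)%C, (Rmin r r'). 
  refine (conj _ (conj _ (conj _ _))).
  - apply Rmin_glb_lt; lra.
  - now apply derivC_lin.
  - now rewrite HA, HA'.
  - intros s Hs. assert (M1 := Rmin_l r r'). assert (M2 := Rmin_r r r').
    rewrite <- HE, <- HE' by lra. ring.
Qed.

Lemma right_jet_ext (h k : R -> C) (A L : C) (r : R) :
  0 < r -> (forall s, 0 < s < r -> h s = k s) -> right_jet h A L -> right_jet k A L.
Proof.
  intros Hr E (H & r' & Hr' & HL & HA & HE).
  exists H, (Rmin r r'). refine (conj _ (conj HL (conj HA _))).
  - apply Rmin_glb_lt; lra.
  - intros s Hs. assert (M1 := Rmin_l r r'). assert (M2 := Rmin_r r r').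
    rewrite <- E by lra. apply HE. lra.
Qed.

(** Extended by 0 to the left, [h] is differentiable at 0, hence a solution
    across 0, and it vanishes on an interval. *)
Lemma lame_zero_jet (nu c : C) (rho : R) (h : R -> C) :
  0 < rho -> solves_lame_on nu c 0 rho h -> right_jet h (RtoC 0) (RtoC 0) ->
  forall s, 0 < s < rho -> h s = RtoC 0.
Proof.
  intros Hrho Hs (H & r & Hr & HL & HA & HE).
  set (F := fun x => if Rlt_dec 0 x then h x else RtoC 0).
  assert (Fpos : forall x, 0 < x -> F x = h x) by (intros x Hx; unfold F; destruct Rlt_dec; [easy|lra]).
  assert (Fneg : forall x, x <= 0 -> F x = RtoC 0) by (intros x Hx; unfold F; destruct Rlt_dec; [lra|easy]).
  assert (HF : solves_lame_on nu c (0 - rho) (0 + rho) F).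
  { apply lame_removable with (D := RtoC 0); [exact Hrho| | |].
    - eapply solves_ext; [|apply solves_zero]. intros x _ Hx. symmetry; apply Fneg. simpl in Hx; lra.
    - rewrite Rplus_0_l. eapply solves_ext; [|exact Hs]. intros x Hx _. symmetry; now apply Fpos.
    - apply (derivC_glue F (fun _ => RtoC 0) H 0 r); [exact Hr| | |apply derivC_const|exact HL].
      + intros x Hx. apply Fneg; lra.
      + intros x Hx. destruct (Req_dec x 0) as [->|Hne].
        * rewrite HA. apply Fneg; lra.
        * rewrite Fpos by lra. apply HE; lra. }
  intros s Hss. rewrite <- Fpos by lra.
  apply (lame_unique nu c (0 - rho) (0 + rho) (0 - rho) 0 F HF); try lra.
  intros x Hx. apply Fneg; lra.
Qed.

Definition parity_sign (e : bool) : C := if e then RtoC 1 else (- RtoC 1)%C.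

(** The jets at 0 of even functions ([e = true]) and of odd functions. *)
Definition parity_jet (e : bool) (h : R -> C) : Prop :=
  exists A L : C, right_jet h A L /\ (if e then L else A) = RtoC 0.

Lemma parity_jet_ext (e : bool) (h k : R -> C) (r : R) :
  0 < r -> (forall s, 0 < s < r -> h s = k s) -> parity_jet e h -> parity_jet e k.
Proof.
  intros Hr E (A & L & H & H0). exists A, L. split; [|exact H0].
  exact (right_jet_ext h k A L r Hr E H).
Qed.

Lemma parity_jet_lin (e : bool) (c d : C) (h k : R -> C) :
  parity_jet e h -> parity_jet e k -> parity_jet e (fun s => c * h s + d * k s)%C.
Proof.
  intros (A & L & H & H0) (B & M & K & K0).
  exists (c * A + d * B)%C, (c * L + d * M)%C. split; [now apply right_jet_lin|].
  destruct e; rewrite H0, K0; ring.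
Qed.

Lemma parity_jet_both (e : bool) (h : R -> C) :
  parity_jet e h -> parity_jet (negb e) h -> right_jet h (RtoC 0) (RtoC 0).
Proof.
  intros (A & L & H & H0) (B & M & K & K0).
  destruct (right_jet_unique _ _ _ _ _ H K) as [-> ->].
  destruct e; simpl in *; subst; exact H.
Qed.

Lemma parity_jet_of_symmetric (e : bool) (h : R -> C) (D : C) :
  derivC h 0 D -> (forall s, h s = parity_sign e * h (- s)%R)%C -> parity_jet e h.
Proof.
  intros HD Hsym. exists (h 0), D. split.
  - exists h, 1. refine (conj Rlt_0_1 (conj HD (conj eq_refl _))). easy.
  - assert (Half : forall z, z = (- RtoC 1 * z)%C -> z = RtoC 0).
    { intros [z1 z2] Hz. unfold RtoC, Cmult, Copp in Hz. simpl in Hz.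
      injection Hz as Hz1 Hz2. apply injective_projections; simpl; lra. }
    destruct e; simpl in *; apply Half.
    + apply (derivC_unique h 0); [exact HD|].
      apply (derivC_ext (fun s => h (- s)) h 0 1); [lra| |].
      * intros s _. rewrite (Hsym s). ring.
      * apply (derivC_val _ _ (RtoC (-1) * D)%C); [rewrite RtoC_m1; reflexivity|].
        apply (derivC_comp h (fun s => - s)); [now rewrite Ropp_0|].
        auto_derive; [easy|ring].
    + generalize (Hsym 0). now rewrite Ropp_0.
Qed.

(** For [e = false], the factor that makes a function of [cos x] odd about [PI]
    while keeping it even about 0: the sign of [cos (x / 2)] is reversed by
    [x -> 2 PI - x].  It is 0 at [PI], where the odd extension vanishes. *)
Definition fold_sign (e : bool) (x : R) : C := if e then RtoC 1 else RtoC (sign (cos (x / 2))).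

Lemma fold_sign_opp e x : fold_sign e (- x) = fold_sign e x.
Proof. destruct e; [easy|]. unfold fold_sign. replace (- x / 2) with (- (x / 2)) by field. now rewrite cos_neg. Qed.

Lemma fold_sign_reflect e x : (fold_sign e (2 * PI - x) = parity_sign e * fold_sign e x)%C.
Proof.
  destruct e; simpl; [ring|].
  replace ((2 * PI - x) / 2) with (PI + -1 * (x / 2)) by field.
  rewrite cos_PI_sub, sign_opp, RtoC_opp. ring.
Qed.

Lemma fold_sign_1 e x : - PI < x < PI -> fold_sign e x = RtoC 1.
Proof.
  intros Hx. destruct e; [easy|]. unfold fold_sign. rewrite sign_eq_1; [easy|].
  apply cos_gt_0; lra.
Qed.

(** [acos (cos x)] folds the line onto [[0, PI]], so [u (acos (cos x))], up to the
    sign, has both symmetries by construction.  The parity of the jets makes it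
    differentiable at 0 and at [PI], so it is a solution on [(- PI, 2 PI)] by
    [lame_removable]; the symmetries carry this to the whole line. *)
Lemma lame_extend (nu c : C) (e : bool) (u : R -> C) :
  solves_lame_on nu c 0 PI u -> parity_jet true u -> parity_jet e (fun s => u (PI - s)) ->
  exists F : R -> C, solves_lame nu c F /\ (forall x, F x = F (- x)) /\
    (forall x, F x = parity_sign e * F (2 * PI - x)%R)%C /\
    (forall x, 0 < x < PI -> F x = u x).
Proof.
  intros Hu (A & L & (H & r & Hr & HL & HA & HE) & L0) (B & M & (H' & r' & Hr' & HL' & HA' & HE') & M0).
  assert (PP := PI_RGT_0).
  (* Folding reaches the end points, where [u] gets its limits as values. *)
  set (v := fun x => if Rle_dec x 0 then A else if Rle_dec PI x then B else u x).
  assert (v0 : v 0 = A) by (unfold v; destruct Rle_dec; [easy|lra]).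
  assert (vPI : v PI = B).
  { unfold v. destruct Rle_dec; [lra|]. destruct Rle_dec; [easy|lra]. }
  assert (vu : forall x, 0 < x < PI -> v x = u x).
  { intros x Hx. unfold v. destruct Rle_dec; [lra|]. destruct Rle_dec; [lra|easy]. }
  set (F := fun x => (fold_sign e x * v (acos (cos x)))%C).
  assert (Fopp : forall x, F x = F (- x)) by (intros x; unfold F; now rewrite fold_sign_opp, cos_neg).
  assert (Frefl : forall x, F x = (parity_sign e * F (2 * PI - x)%R)%C).
  { intros x. unfold F. rewrite fold_sign_reflect, cos_2PI_sub. destruct e; simpl; ring. }
  assert (Fin : forall x, 0 <= x < PI -> F x = v x).
  { intros x Hx. unfold F. rewrite fold_sign_1, acos_cos by lra. ring. }
  assert (Fu : forall x, 0 < x < PI -> F x = u x) by (intros x Hx; rewrite Fin, vu; auto; lra).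
  assert (FPI : F PI = B).
  { unfold F. rewrite acos_cos, vPI by lra. destruct e; simpl in *; [ring|]. rewrite M0; ring. }
  assert (S0 : solves_lame_on nu c 0 PI F).
  { eapply solves_ext; [|exact Hu]. intros x h1 h2. symmetry. now apply Fu. }
  assert (Sm : solves_lame_on nu c (- PI) 0 F).
  { eapply solves_ext; [|rewrite <- Ropp_0; apply (lame_reflect_0 nu c _ _ _ S0)].
    intros x _ _. symmetry. apply Fopp. }
  assert (Sp : solves_lame_on nu c PI (2 * PI) F).
  { assert (K := lame_shift_2PI nu c _ _ _ (lame_reflect_0 nu c _ _ _ Sm)).
    assert (K2 := lame_reflect_0 nu c _ _ _ K).
    eapply solves_ext; [|apply (lame_scal nu c _ _ (parity_sign e)); 
       eapply solves_sub; [| |exact K2]].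
    - intros x _ _. cbv beta. rewrite (Frefl x).
      replace (- (- x + 2 * PI)) with (- (2 * PI - x)) by ring.
      now rewrite <- Fopp.
    - simpl; lra.
    - simpl; lra. }
  assert (D0 : derivC F 0 (RtoC 0)).
  { simpl in L0. apply (derivC_glue F (fun s => H (- s)) H 0 (Rmin r PI)).
    - apply Rmin_glb_lt; lra.
    - intros x Hx. assert (M1 := Rmin_l r PI). assert (M2 := Rmin_r r PI).
      rewrite Fopp. destruct (Req_dec x 0) as [->|Hne].
      + rewrite Ropp_0, Fin, v0, HA by lra. reflexivity.
      + rewrite Fu by lra. apply HE. lra.
    - intros x Hx. assert (M1 := Rmin_l r PI). assert (M2 := Rmin_r r PI).
      destruct (Req_dec x 0) as [->|Hne].
      + rewrite Fin, v0, HA by lra. reflexivity.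
      + rewrite Fu by lra. apply HE. lra.
    - apply (derivC_val _ _ (RtoC (-1) * L)%C); [rewrite L0; ring|].
      apply (derivC_comp H (fun s => - s)); [now rewrite Ropp_0|].
      auto_derive; [easy|ring].
    - now rewrite <- L0. }
  assert (DPI : derivC F PI (- M)%C).
  { assert (Hleft : forall x, 0 <= x < Rmin r' PI -> F (PI - x) = H' x).
    { intros x Hx. assert (M1 := Rmin_l r' PI). assert (M2 := Rmin_r r' PI).
      destruct (Req_dec x 0) as [->|Hne].
      - rewrite Rminus_0_r, FPI, HA'. reflexivity.
      - rewrite Fu by lra. apply HE'. lra. }
    apply (derivC_glue F (fun x => H' (PI - x)) (fun x => parity_sign e * H' (x - PI)%R)%C PI (Rmin r' PI)).
    - apply Rmin_glb_lt; lra.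
    - intros x Hx. rewrite <- Hleft by lra. f_equal; ring.
    - intros x Hx. rewrite <- Hleft by lra. rewrite Frefl. do 2 f_equal; ring.
    - apply (derivC_val _ _ (RtoC (-1) * M)%C); [rewrite RtoC_m1; ring|].
      apply (derivC_comp H' (fun s => PI - s)); [now rewrite Rminus_diag|].
      auto_derive; [easy|ring].
    - eapply derivC_val; [|apply (derivC_mult (fun _ => parity_sign e)); [apply derivC_const|]].
      2:{ apply (derivC_comp H' (fun s => s - PI) PI 1); [rewrite Rminus_diag; exact HL'|].
          auto_derive; [easy|ring]. }
      destruct e; simpl in *; [rewrite M0|]; ring. }
  assert (SA : solves_lame_on nu c (0 - PI) (0 + PI) F).
  { apply lame_removable with (D := RtoC 0); [exact PP| | |exact D0].
    - now rewrite Rminus_0_l.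
    - now rewrite Rplus_0_l. }
  assert (SB : solves_lame_on nu c (PI - PI) (PI + PI) F).
  { apply lame_removable with (D := (- M)%C); [exact PP| | |exact DPI].
    - now rewrite Rminus_diag.
    - now replace (PI + PI) with (2 * PI) by ring. }
  (* The symmetries transport solutions locally, so it is enough to show that
     every point has a neighbourhood on which [F] is a solution. *)
  set (Loc := fun x => exists d, 0 < d /\ solves_lame_on nu c (x - d) (x + d) F).
  assert (L1 : forall x, - PI < x < 2 * PI -> Loc x).
  { intros x Hx. destruct (Rle_dec x 0).
    - exists (x + PI). split; [lra|].
      eapply solves_sub; [| |exact SA]; simpl; lra.
    - exists (Rmin x (2 * PI - x)). split; [apply Rmin_glb_lt; lra|].
      assert (M1 := Rmin_l x (2 * PI - x)). assert (M2 := Rmin_r x (2 * PI - x)).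
      eapply solves_sub; [| |exact SB]; simpl; lra. }
  assert (Fper : forall x, F (x + 2 * PI) = (parity_sign e * F x)%C).
  { intros x. rewrite (Frefl (x + 2 * PI)), (Fopp x). do 2 f_equal. ring. }
  assert (Lm : forall x, Loc (x + 2 * PI) -> Loc x).
  { intros x (d & Hd & K). exists d. split; [exact Hd|].
    assert (K2 := lame_scal nu c _ _ (parity_sign e) _ (lame_shift_2PI nu c _ _ _ K)).
    eapply solves_ext; [|eapply solves_sub; [| |exact K2]].
    - intros y _ _. cbv beta. rewrite Fper. destruct e; simpl; ring.
    - simpl; lra.
    - simpl; lra. }
  assert (Lo : forall x, Loc x -> Loc (- x)).
  { intros x (d & Hd & K). exists d. split; [exact Hd|].
    eapply solves_ext; [|eapply solves_sub; [| |exact (lame_reflect_0 nu c _ _ _ K)]].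
    - intros y _ _. cbv beta. symmetry; apply Fopp.
    - simpl; lra.
    - simpl; lra. }
  assert (Ln : forall (n : nat) x, - PI - 2 * PI * INR n < x < 2 * PI -> Loc x).
  { induction n as [|n IH]; intros x Hx.
    - apply L1. simpl in Hx; lra.
    - rewrite S_INR in Hx. destruct (Rlt_dec x 0).
      + apply Lm, IH. lra.
      + apply L1; lra. }
  assert (Lall : forall x, Loc x).
  { assert (Lneg : forall x, x <= 0 -> Loc x).
    { intros x Hx. destruct (INR_unbounded (- x / (2 * PI))) as [n Hn].
      apply (Ln n). split; [|lra].
      apply (Rmult_lt_compat_r (2 * PI)) in Hn; [|lra].
      replace (- x / (2 * PI) * (2 * PI)) with (- x) in Hn by (field; lra). lra. }
    intros x. destruct (Rle_dec x 0); [now apply Lneg|].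
    rewrite <- (Ropp_involutive x). apply Lo, Lneg. lra. }
  exists F. refine (conj _ (conj Fopp (conj Frefl Fu))).
  apply solves_local. intros x _ _. apply Lall.
Qed.

(** The image in the Lamé variable of a Frobenius basis seen from one side of its
    singular point: two independent solutions near 0 that span all solutions and
    have opposite parities, [k] that of [e]. *)
Definition end_basis (nu c : C) (e : bool) (k l : R -> C) : Prop :=
  parity_jet e k /\ parity_jet (negb e) l /\
  exists rho, 0 < rho <= PI /\
    solves_lame_on nu c 0 rho k /\ solves_lame_on nu c 0 rho l /\
    (forall T, solves_lame_on nu c 0 rho T ->
       exists c1 c2 : C, forall s, 0 < s < rho -> T s = (c1 * k s + c2 * l s)%C) /\
    (forall c1 c2 : C, (forall s, 0 < s < rho -> (c1 * k s + c2 * l s)%C = RtoC 0) ->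
       c1 = RtoC 0 /\ c2 = RtoC 0).

Lemma end_basis_swap (nu c : C) (e : bool) (k l : R -> C) :
  end_basis nu c e k l -> end_basis nu c (negb e) l k.
Proof.
  intros (H1 & H2 & rho & Hr & Hk & Hl & Hs & Hi).
  refine (conj H2 (conj _ (ex_intro _ rho (conj Hr (conj Hl (conj Hk (conj _ _))))))).
  - now rewrite Bool.negb_involutive.
  - intros T HT. destruct (Hs T HT) as (c1 & c2 & E). exists c2, c1.
    intros s Hss. rewrite E by exact Hss. ring.
  - intros c1 c2 E. destruct (Hi c2 c1); [|now split].
    intros s Hss. rewrite <- (E s Hss). ring.
Qed.

(** Write [T = c1 k + c2 l] near 0.  Then [c2 l = T - c1 k] has both parities, so
    its Cauchy data at 0 vanish and it is 0 by [lame_zero_jet]. *)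
Lemma parity_solution_multiple (nu c : C) (e : bool) (k l u T : R -> C) (r : R) :
  end_basis nu c e k l ->
  solves_lame_on nu c 0 PI u -> 0 < r -> (forall s, 0 < s < r -> u s = k s) ->
  solves_lame_on nu c 0 PI T -> parity_jet e T ->
  exists m : C, forall s, 0 < s < PI -> T s = (m * u s)%C.
Proof.
  intros (Jk & Jl & rho & Hrho & Sk & Sl & Span & Ind) Su Hr Euk ST JT.
  assert (ST' : solves_lame_on nu c 0 rho T) by (eapply solves_sub; [| |exact ST]; simpl; lra).
  destruct (Span T ST') as (c1 & c2 & E).
  assert (J0 : right_jet (fun s => c2 * l s)%C (RtoC 0) (RtoC 0)).
  { apply (parity_jet_both e).
    - apply (parity_jet_ext e (fun s => RtoC 1 * T s + - c1 * k s)%C _ rho); [lra| |now apply parity_jet_lin].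
      intros s Hs. rewrite E by exact Hs. ring.
    - apply (parity_jet_ext (negb e) (fun s => c2 * l s + RtoC 0 * l s)%C _ rho); [lra| |now apply parity_jet_lin].
      intros s Hs. ring. }
  assert (Z := lame_zero_jet nu c rho _ ltac:(lra) (lame_scal nu c _ _ c2 _ Sl) J0).
  exists c1. apply (lame_agree nu c 0 PI 0 (Rmin r rho) T (fun s => c1 * u s)%C).
  - exact ST.
  - now apply lame_scal.
  - lra.
  - apply Rmin_glb_lt; lra.
  - eapply Rle_trans; [apply Rmin_r|lra].
  - intros s Hs. assert (M1 := Rmin_l r rho). assert (M2 := Rmin_r r rho).
    rewrite E, Z, Euk by lra. ring.
Qed.

(** The connection problem for the Lamé equation on [(0, PI)]: a global solution
    that is even about 0 and has parity [e] about [PI] restricts to a multiple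
    of [u] and, seen from [PI], to a multiple of [v]; it exists exactly when
    [u] and [v] are proportional. *)
Lemma matching (nu c : C) (e : bool) (f g k l u v w : R -> C) (m m' : C) (r : R) :
  end_basis nu c true f g -> end_basis nu c e k l ->
  solves_lame_on nu c 0 PI u -> solves_lame_on nu c 0 PI v -> solves_lame_on nu c 0 PI w ->
  0 < r ->
  (forall s, 0 < s < r -> u s = f s) ->
  (forall s, 0 < s < r -> v (PI - s) = k s) ->
  (forall s, 0 < s < r -> w (PI - s) = l s) ->
  (forall s, 0 < s < PI -> u s = (m * v s + m' * w s)%C) ->
  m' = RtoC 0 <->
  exists F : R -> C, nontrivial F /\ solves_lame nu c F /\
    (forall x, F x = F (- x)) /\ (forall x, F x = parity_sign e * F (2 * PI - x)%R)%C.
Proof.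
  intros B0 B1 Su Sv Sw Hr Eu Ev Ew Em.
  assert (PP := PI_RGT_0).
  assert (Refl : forall h, solves_lame_on nu c 0 PI h -> solves_lame_on nu c 0 PI (fun s => h (PI - s))).
  { intros h Hh. generalize (lame_reflect_PI nu c _ _ _ Hh). now rewrite Rminus_diag, Rminus_0_r. }
  set (r1 := Rmin r PI).
  assert (Hr1 : 0 < r1 <= PI /\ r1 <= r).
  { unfold r1. split; [split; [apply Rmin_glb_lt; lra|apply Rmin_r]|apply Rmin_l]. }
  split.
  - intros ->.
    destruct (lame_extend nu c e u Su) as (F & HF & Fo & Fr & Fu).
    + apply (parity_jet_ext true f u r Hr); [intros; symmetry; auto|apply B0].
    + apply (parity_jet_ext e (fun s => m * k s + RtoC 0 * k s)%C _ r1); [lra| |].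
      * intros s Hs. rewrite Em, <- Ev by lra. ring.
      * apply parity_jet_lin; apply B1.
    + exists F. refine (conj _ (conj HF (conj Fo Fr))).
      destruct B0 as (_ & _ & rho & Hrho & Sf & _ & _ & Ind).
      assert (Hex : ~ forall s, 0 < s < PI -> u s = RtoC 0).
      { intros H0. destruct (Ind (RtoC 1) (RtoC 0)) as [H1 _].
        - intros s Hs. rewrite (lame_unique nu c 0 rho 0 (Rmin r1 rho) f Sf); [ring|lra| | | |exact Hs].
          + apply Rmin_glb_lt; lra.
          + apply Rmin_r.
          + intros x Hx. assert (M1 := Rmin_l r1 rho). assert (M2 := Rmin_r r1 rho).
            rewrite <- Eu by lra. apply H0; lra.
        - apply RtoC_inj in H1. lra. }
      unfold nontrivial. apply NNPP. intros Hn. apply Hex.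
      intros s Hs. rewrite <- Fu by exact Hs. apply NNPP. intros Hne.
      apply Hn. now exists s.
  - intros (F & [x0 Hx0] & HF & Fo & Fr).
    assert (SF : solves_lame_on nu c 0 PI F) by (eapply solves_sub; [| |exact HF]; exact I).
    destruct (HF) as (dF & ddF & HdF).
    assert (DF : forall x, derivC F x (dF x)) by (intros x; now apply HdF).
    destruct (parity_solution_multiple nu c true f g u F r B0 Su Hr Eu SF) as [c1 H1].
    { apply (parity_jet_of_symmetric true F (dF 0)); [apply DF|].
      intros s. rewrite (Fo s). simpl. ring. }
    destruct (parity_solution_multiple nu c e k l (fun s => v (PI - s)) (fun s => F (PI - s))
                r B1 (Refl _ Sv) Hr Ev (Refl _ SF)) as [d1 H2].
    { apply (parity_jet_of_symmetric e (fun s => F (PI - s)) (RtoC (-1) * dF (PI - 0)%R)%C).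
      - apply (derivC_comp F (fun s => PI - s)); [apply DF|]. auto_derive; [easy|ring].
      - intros s. rewrite Fr. do 2 f_equal. ring. }
    assert (Hc1 : c1 <> RtoC 0).
    { intros ->. apply Hx0.
      apply (lame_unique nu c (- Rabs x0 - 1) (Rabs x0 + PI) 0 PI F).
      - eapply solves_sub; [| |exact HF]; exact I.
      - assert (P := Rabs_pos x0). lra.
      - lra.
      - assert (P := Rabs_pos x0). lra.
      - intros x Hx. rewrite H1 by exact Hx. ring.
      - assert (K := Rabs_le_between x0 (Rabs x0)). destruct K as [K _].
        specialize (K (Rle_refl _)). lra. }
    destruct B1 as (_ & _ & rho & Hrho & Sk & Sl & _ & Ind).
    destruct (Ind (c1 * m - d1)%C (c1 * m')%C) as [_ Hz].
    + apply (lame_unique nu c 0 rho 0 (Rmin r1 rho) (fun s => (c1 * m - d1) * k s + c1 * m' * l s)%C).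
      * now apply solves_lin.
      * lra.
      * apply Rmin_glb_lt; lra.
      * apply Rmin_r.
      * intros s Hs. assert (M1 := Rmin_l r1 rho). assert (M2 := Rmin_r r1 rho).
        rewrite <- Ev, <- Ew by lra.
        assert (E1 := H1 (PI - s) ltac:(lra)). rewrite (H2 s) in E1 by lra.
        rewrite Em in E1 by lra.
        transitivity (c1 * (m * v (PI - s)%R + m' * w (PI - s)%R) - d1 * v (PI - s)%R)%C; [ring|].
        rewrite <- E1. ring.
    + destruct (Ceq_dec m' (RtoC 0)) as [|Hm]; [assumption|].
      exfalso. now apply (Cmult_neq_0 c1 m').
Qed.

(** * The change of variable *)

Lemma is_derive_acos (x : R) : -1 < x < 1 -> is_derive acos x (- / sqrt (1 - x ^ 2)).
Proof.
  intros Hx. apply is_derive_Reals.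
  apply (derive_pt_eq_1 acos x _ (derivable_pt_acos x Hx)).
  rewrite derive_pt_acos. unfold Rsqr, Rdiv. replace (x ^ 2) with (x * x) by ring. ring.
Qed.

(** The distance of [beta] from the singular point [PI / 2] as a function of
    [chi] on [[0, PI]], obtained by inverting
    [cos chi = sqrt 2 * cos (beta / 2)].  The same function of [tau] gives the
    distance on the other side, and [gap_reflect] gives the distance from the
    other end of the segment. *)
Definition gap (s : R) : R := 2 * acos (cos s / sqrt 2) - PI / 2.

(** The map [chi] itself, at [beta = PI / 2 + t]. *)
Definition gap_inv (t : R) : R := acos (sqrt 2 * cos (t / 2 + PI / 4)).

Lemma sqrt2_sq : sqrt 2 * sqrt 2 = 2.
Proof. apply sqrt_sqrt; lra. Qed.

Lemma sqrt2_pos : 0 < sqrt 2.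
Proof. apply sqrt_lt_R0; lra. Qed.

Lemma cos_div_sqrt2_bound s : -1 < cos s / sqrt 2 < 1.
Proof.
  assert (B := COS_bound s). assert (P := sqrt2_pos). assert (Q := sqrt2_sq).
  assert (1 < sqrt 2) by nra.
  split; [apply Rlt_div_r|apply Rlt_div_l]; lra.
Qed.

Lemma one_sub_half_cos_sq s : sqrt (1 - (cos s / sqrt 2) ^ 2) = sqrt (2 - cos s ^ 2) / sqrt 2.
Proof.
  assert (D := lame_den_bounds s). assert (P := sqrt2_pos). assert (Q := sqrt2_sq).
  rewrite <- sqrt_div by lra. f_equal.
  replace ((cos s / sqrt 2) ^ 2) with (cos s ^ 2 / (sqrt 2 * sqrt 2)) by (field; lra).
  rewrite Q. field.
Qed.

(** This is [- cos beta = sin chi ^ 2].  It turns the simple pole of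
    [a / cos beta] into a regular term, since [gap' ^ 2] is a multiple of
    [sin chi ^ 2]. *)
Lemma sin_gap s : sin (gap s) = sin s ^ 2.
Proof.
  unfold gap. replace (2 * acos (cos s / sqrt 2) - PI / 2) with (- (PI / 2 - 2 * acos (cos s / sqrt 2))) by ring.
  assert (B := cos_div_sqrt2_bound s). assert (P := sqrt2_pos). assert (Q := sqrt2_sq).
  rewrite sin_neg, sin_shift, cos_2a_cos, cos_acos by lra.
  replace (2 * (cos s / sqrt 2) * (cos s / sqrt 2)) with (2 * cos s ^ 2 / (sqrt 2 * sqrt 2)) by (field; lra).
  rewrite Q. assert (E := sin2_cos2 s). unfold Rsqr in E. simpl. lra.
Qed.

Lemma cos_gap s : cos (gap s) = cos s * sqrt (2 - cos s ^ 2).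
Proof.
  unfold gap. replace (2 * acos (cos s / sqrt 2) - PI / 2) with (- (PI / 2 - 2 * acos (cos s / sqrt 2))) by ring.
  assert (B := cos_div_sqrt2_bound s). assert (P := sqrt2_pos). assert (Q := sqrt2_sq).
  rewrite cos_neg, cos_shift, sin_2a, cos_acos, sin_acos by lra.
  replace (1 - (cos s / sqrt 2)²) with (1 - (cos s / sqrt 2) ^ 2) by (unfold Rsqr; ring).
  rewrite one_sub_half_cos_sq.
  replace (2 * (sqrt (2 - cos s ^ 2) / sqrt 2) * (cos s / sqrt 2))
    with (2 * sqrt (2 - cos s ^ 2) * cos s / (sqrt 2 * sqrt 2)) by (field; lra).
  rewrite Q. field.
Qed.

Lemma gap_0 : gap 0 = 0.
Proof.
  unfold gap. rewrite cos_0. replace (1 / sqrt 2) with (cos (PI / 4)) by apply cos_PI4.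
  assert (P := PI_RGT_0). rewrite acos_cos by lra. field.
Qed.

Lemma gap_range s : 0 < s < PI -> 0 < gap s < PI.
Proof.
  intros Hs. assert (P := PI_RGT_0).
  assert (Hb := acos_bound (cos s / sqrt 2)).
  assert (Hp : 0 < sin (gap s)) by (rewrite sin_gap; apply pow_lt, sin_gt_0; lra).
  assert (Hr : - (PI / 2) <= gap s <= 3 * PI / 2) by (unfold gap; lra).
  split.
  - apply Rnot_le_lt. intros h. assert (sin (gap s) <= 0); [|lra].
    rewrite <- (Ropp_involutive (gap s)), sin_neg. assert (0 <= sin (- gap s)) by (apply sin_ge_0; lra). lra.
  - apply Rnot_le_lt. intros h. assert (sin (gap s) <= 0); [|lra].
    assert (0 <= sin (gap s - PI)) by (apply sin_ge_0; lra).
    rewrite sin_minus, cos_PI, sin_PI in H. lra.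
Qed.

Lemma gap_reflect s : gap (PI - s) = PI - gap s.
Proof.
  unfold gap. replace (PI - s) with (PI + -1 * s) at 1 by ring. rewrite cos_PI_sub.
  unfold Rdiv at 1. rewrite Ropp_mult_distr_l_reverse, acos_opp. unfold Rdiv. field.
Qed.

Lemma gap_increasing x y : 0 <= x -> x < y -> y <= PI -> gap x < gap y.
Proof.
  intros Hx Hxy Hy. assert (P := sqrt2_pos).
  assert (Hc : cos y < cos x) by (apply cos_decreasing_1; lra).
  assert (B1 := cos_div_sqrt2_bound x). assert (B2 := cos_div_sqrt2_bound y).
  assert (A1 := acos_bound (cos x / sqrt 2)). assert (A2 := acos_bound (cos y / sqrt 2)).
  assert (acos (cos x / sqrt 2) < acos (cos y / sqrt 2)); [|unfold gap; lra].
  apply cos_decreasing_0; try lra. rewrite !cos_acos by lra.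
  apply Rmult_lt_compat_r; [now apply Rinv_0_lt_compat|exact Hc].
Qed.

Lemma cos_gap_inv_sq t : (sqrt 2 * cos (t / 2 + PI / 4)) ^ 2 = 1 - sin t.
Proof.
  replace (sin t) with (- cos (2 * (t / 2 + PI / 4))).
  - rewrite cos_2a_cos. assert (Q := sqrt2_sq).
    replace ((sqrt 2 * cos (t / 2 + PI / 4)) ^ 2)
      with ((sqrt 2 * sqrt 2) * cos (t / 2 + PI / 4) ^ 2) by ring. rewrite Q. ring.
  - replace (2 * (t / 2 + PI / 4)) with (PI / 2 - (- t)) by field.
    rewrite cos_shift, sin_neg. ring.
Qed.

Lemma gap_gap_inv t : 0 <= t <= PI -> gap (gap_inv t) = t.
Proof.
  intros Ht. assert (P := sqrt2_pos). assert (Hs : 0 <= sin t) by (apply sin_ge_0; lra).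
  assert (E := cos_gap_inv_sq t).
  unfold gap, gap_inv. rewrite cos_acos by (split; nra).
  replace (sqrt 2 * cos (t / 2 + PI / 4) / sqrt 2) with (cos (t / 2 + PI / 4)) by (field; lra).
  rewrite acos_cos by lra. field.
Qed.

Lemma gap_inv_bounds t : 0 < t <= PI -> 0 < gap_inv t <= PI.
Proof.
  intros Ht. assert (B := acos_bound (sqrt 2 * cos (t / 2 + PI / 4))). fold (gap_inv t) in B.
  split; [|lra]. apply Rnot_le_lt. intros h.
  assert (E : gap (gap_inv t) = t) by (apply gap_gap_inv; lra).
  replace (gap_inv t) with 0 in E by lra. rewrite gap_0 in E. lra.
Qed.

Lemma gap_below r s : 0 < r <= PI -> 0 < s < gap_inv r -> 0 < gap s < r.
Proof.
  intros Hr Hs. assert (B := gap_inv_bounds r Hr).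
  split; [apply gap_range; lra|].
  rewrite <- (gap_gap_inv r) by lra. apply gap_increasing; lra.
Qed.

Lemma gap_inv_below r t : 0 < t < r -> r <= PI -> 0 < gap_inv t < gap_inv r.
Proof.
  intros Ht Hr. assert (B := gap_inv_bounds t ltac:(lra)). split; [lra|].
  assert (B' := gap_inv_bounds r ltac:(lra)).
  apply Rnot_le_lt. intros h. 
  assert (E1 := gap_gap_inv t ltac:(lra)). assert (E2 := gap_gap_inv r ltac:(lra)).
  destruct h as [h|h].
  - assert (K := gap_increasing (gap_inv r) (gap_inv t) ltac:(lra) h ltac:(lra)). lra.
  - rewrite h in E2. lra.
Qed.

Lemma gap_inv_gap s : 0 < s < PI -> gap_inv (gap s) = s.
Proof.
  intros Hs. assert (B := gap_range s Hs). assert (P := PI_RGT_0).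
  assert (B' := gap_inv_bounds (gap s) ltac:(lra)).
  assert (E := gap_gap_inv (gap s) ltac:(lra)).
  destruct (Rtotal_order (gap_inv (gap s)) s) as [h|[h|h]]; [|exact h|].
  - assert (K := gap_increasing (gap_inv (gap s)) s ltac:(lra) h ltac:(lra)). lra.
  - assert (K := gap_increasing s (gap_inv (gap s)) ltac:(lra) h ltac:(lra)). lra.
Qed.

Lemma is_derive_gap s : is_derive gap s (2 * sin s / sqrt (2 - cos s ^ 2)).
Proof.
  assert (D := lame_den_bounds s). assert (P := sqrt2_pos). assert (Q := sqrt2_sq).
  assert (R0 := sqrt_lt_R0 (2 - cos s ^ 2) ltac:(lra)).
  assert (Hi : is_derive (fun t => cos t / sqrt 2) s (- sin s / sqrt 2)).
  { auto_derive; [easy|field; lra]. }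
  assert (Ha := is_derive_comp acos _ s _ _ (is_derive_acos _ (cos_div_sqrt2_bound s)) Hi).
  assert (H2 := is_derive_scal _ _ 2 _ Ha).
  assert (H3 := is_derive_minus (V := R_NormedModule) _ _ _ _ _ H2
                  (is_derive_const (V := R_NormedModule) (PI / 2) s)).
  eapply eq_ind; [exact H3|].
  rewrite one_sub_half_cos_sq. unfold minus, plus, opp, zero, scal; simpl. unfold mult; simpl.
  simpl in R0. field. lra.
Qed.

Lemma is_derive_dgap s :
  is_derive (fun s => 2 * sin s / sqrt (2 - cos s ^ 2)) s (2 * cos s / sqrt (2 - cos s ^ 2) ^ 3).
Proof.
  assert (D := lame_den_bounds s). assert (R0 := sqrt_lt_R0 (2 - cos s ^ 2) ltac:(lra)).
  assert (S := sqrt_sqrt (2 - cos s ^ 2) ltac:(lra)).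
  assert (E := sin2_cos2 s). unfold Rsqr in E.
  auto_derive.
  - replace (2 + - (cos s * (cos s * 1))) with (2 - cos s ^ 2) by (simpl; ring). repeat split; lra.
  - replace (2 + - (cos s * (cos s * 1))) with (2 - cos s ^ 2) by (simpl; ring).
    set (d := sqrt (2 - cos s ^ 2)) in *.
    assert (Ed : d * d - sin s * sin s = 1) by (rewrite S; simpl; lra).
    replace (2 * cos s / d ^ 3) with (2 * cos s * (d * d - sin s * sin s) / d ^ 3)
      by (rewrite Ed; unfold Rdiv; ring).
    field. lra.
Qed.

Lemma is_derive_gap_inv t : 0 < t < PI ->
  is_derive gap_inv t (sqrt 2 * sin (t / 2 + PI / 4) / (2 * sqrt (sin t))).
Proof.
  intros Ht. assert (P := sqrt2_pos). assert (S0 := sin_gt_0 t ltac:(lra) ltac:(lra)).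
  assert (E := cos_gap_inv_sq t). assert (S1 := sqrt_lt_R0 _ S0).
  assert (Hi : is_derive (fun t => sqrt 2 * cos (t / 2 + PI / 4)) t (- (sqrt 2 * sin (t / 2 + PI / 4) / 2))).
  { auto_derive; [easy|]. unfold Rdiv. field. }
  assert (Ha := is_derive_comp acos _ t _ _ (is_derive_acos (sqrt 2 * cos (t / 2 + PI / 4)) ltac:(split; nra)) Hi).
  eapply eq_ind; [exact Ha|].
  rewrite E. replace (1 - (1 - sin t)) with (sin t) by ring.
  unfold scal; simpl. unfold mult; simpl. field. lra.
Qed.

Lemma sqrt2_sin_sq t : (sqrt 2 * sin (t / 2 + PI / 4)) ^ 2 = 1 + sin t.
Proof.
  assert (Q := sqrt2_sq). assert (E := cos_gap_inv_sq t).
  assert (E2 := sin2_cos2 (t / 2 + PI / 4)). unfold Rsqr in E2.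
  replace ((sqrt 2 * sin (t / 2 + PI / 4)) ^ 2)
    with ((sqrt 2 * sqrt 2) * (sin (t / 2 + PI / 4) * sin (t / 2 + PI / 4))) by ring.
  replace ((sqrt 2 * cos (t / 2 + PI / 4)) ^ 2)
    with ((sqrt 2 * sqrt 2) * (cos (t / 2 + PI / 4) * cos (t / 2 + PI / 4))) in E by ring.
  rewrite Q in *. lra.
Qed.

Lemma cos_gap_inv_prod t :
  cos t = (sqrt 2 * sin (t / 2 + PI / 4)) * (sqrt 2 * cos (t / 2 + PI / 4)).
Proof.
  assert (Q := sqrt2_sq).
  transitivity (sin (2 * (t / 2 + PI / 4))).
  - replace (2 * (t / 2 + PI / 4)) with (PI / 2 - (- t)) by field. now rewrite sin_shift, cos_neg.
  - rewrite sin_2a. rewrite <- Q at 1. ring.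
Qed.

Lemma is_derive_dgap_inv t : 0 < t < PI ->
  is_derive (fun t => sqrt 2 * sin (t / 2 + PI / 4) / (2 * sqrt (sin t))) t
    (- (sqrt 2 * cos (t / 2 + PI / 4)) / (4 * sqrt (sin t) ^ 3)).
Proof.
  intros Ht. assert (S0 := sin_gt_0 t ltac:(lra) ltac:(lra)).
  assert (S1 := sqrt_lt_R0 _ S0). assert (S2 := sqrt_sqrt (sin t) ltac:(lra)).
  auto_derive; [repeat split; lra|].
  assert (E1 := sqrt2_sin_sq t). assert (E2 := cos_gap_inv_prod t).
  replace (t * / 2 + PI / 4) with (t / 2 + PI / 4) by (unfold Rdiv; ring).
  set (y := sqrt 2 * sin (t / 2 + PI / 4)) in *. set (x := sqrt 2 * cos (t / 2 + PI / 4)) in *.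
  set (z := sqrt (sin t)) in *. rewrite E2.
  transitivity ((x * (z * z - y ^ 2)) / (4 * z ^ 3)).
  - unfold x, y. field. lra.
  - rewrite E1, S2. unfold Rdiv. ring.
Qed.

(** Near each of the three singular points, and on each side of it, the equation
    has the same form in the distance [t] to the point, with [a'] equal to [a] or
    [- a]. *)
Definition gap_p (t : R) : R := cos t / (2 * sin t).
Definition gap_q (a' b : C) (t : R) : C := (a' * RtoC (/ sin t) + b)%C.
Notation solves_gap a' b := (solves_linear_ode (fun t => RtoC (gap_p t)) (gap_q a' b)).

Lemma gap_to_lame (a' b nu : C) (r : R) (T : R -> C) :
  (nu * (nu + 1) = 4 * b)%C -> 0 < r <= PI ->
  solves_gap a' b 0 r T ->
  solves_lame_on nu (4 * a')%C 0 (gap_inv r) (fun s => T (gap s)).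
Proof.
  intros Hnu Hr. assert (B := gap_inv_bounds r Hr).
  apply (solves_change_var _ _ _ _ gap (fun s => 2 * sin s / sqrt (2 - cos s ^ 2))
    (fun s => 2 * cos s / sqrt (2 - cos s ^ 2) ^ 3)).
  intros s h1 h2. simpl in h1, h2.
  refine (conj (gap_below r s Hr (conj h1 h2)) (conj (is_derive_gap s) (conj (is_derive_dgap s) _))).
  assert (D := lame_den_bounds s). assert (R0 := sqrt_lt_R0 (2 - cos s ^ 2) ltac:(lra)).
  assert (S := sqrt_sqrt (2 - cos s ^ 2) ltac:(lra)).
  assert (S0 := sin_gt_0 s h1 ltac:(lra)).
  assert (E := sin2_cos2 s). unfold Rsqr in E.
  split.
  - rewrite <- RtoC_pow, <- !RtoC_mult, <- RtoC_plus. f_equal.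
    unfold lame_p, gap_p. rewrite sin_gap, cos_gap.
    set (d := sqrt (2 - cos s ^ 2)) in *.
    replace (2 - cos s ^ 2) with (d * d).
    replace (2 * cos s / d ^ 3) with (2 * cos s * (d * d - sin s ^ 2) / d ^ 3).
    + field. lra.
    + replace (d * d - sin s ^ 2) with 1; [unfold Rdiv; ring|]. rewrite S. simpl. lra.
  - unfold lame_q, gap_q. rewrite sin_gap, Hnu, <- RtoC_pow.
    set (d := sqrt (2 - cos s ^ 2)) in *. rewrite <- S.
    assert (Hd : d * d <> 0) by nra. unfold Cdiv. rewrite <- RtoC_inv by exact Hd.
    replace ((2 * sin s / d) ^ 2) with (4 * (sin s ^ 2 / (d * d))) by (field; lra).
    replace (/ (d * d)) with (/ sin s ^ 2 * (sin s ^ 2 / (d * d))) by (field; lra).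
    rewrite !RtoC_mult. ring.
Qed.

Lemma lame_to_gap (a' b nu : C) (r : R) (T : R -> C) :
  (nu * (nu + 1) = 4 * b)%C -> 0 < r <= PI ->
  solves_lame_on nu (4 * a')%C 0 (gap_inv r) T ->
  solves_gap a' b 0 r (fun t => T (gap_inv t)).
Proof.
  intros Hnu Hr.
  apply (solves_change_var _ _ _ _ gap_inv (fun t => sqrt 2 * sin (t / 2 + PI / 4) / (2 * sqrt (sin t)))
    (fun t => - (sqrt 2 * cos (t / 2 + PI / 4)) / (4 * sqrt (sin t) ^ 3))).
  intros t h1 h2. simpl in h1, h2.
  refine (conj (gap_inv_below r t (conj h1 h2) (proj2 Hr))
    (conj (is_derive_gap_inv t ltac:(lra)) (conj (is_derive_dgap_inv t ltac:(lra)) _))).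
  assert (S0 := sin_gt_0 t ltac:(lra) ltac:(lra)).
  assert (S1 := sqrt_lt_R0 _ S0). assert (S2 := sqrt_sqrt (sin t) ltac:(lra)).
  assert (E0 := cos_gap_inv_sq t). assert (E1 := sqrt2_sin_sq t). assert (E2 := cos_gap_inv_prod t).
  assert (Ec : cos (gap_inv t) = sqrt 2 * cos (t / 2 + PI / 4)) by (apply cos_acos; split; nra).
  assert (Es : sin (gap_inv t) = sqrt (sin t)).
  { unfold gap_inv. rewrite sin_acos by (split; nra). f_equal. unfold Rsqr. nra. }
  set (y := sqrt 2 * sin (t / 2 + PI / 4)) in *. set (x := sqrt 2 * cos (t / 2 + PI / 4)) in *.
  set (z := sqrt (sin t)) in *.
  assert (Hy : y <> 0) by nra.
  assert (Hden : 2 - x ^ 2 = y ^ 2) by lra.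
  split.
  - rewrite <- RtoC_pow, <- !RtoC_mult, <- RtoC_plus. f_equal.
    unfold lame_p, gap_p. rewrite Ec, Es, E2, Hden, <- S2.
    replace (- x / (4 * z ^ 3)) with (- x * (y ^ 2 - z * z) / (4 * z ^ 3)).
    + field. lra.
    + replace (y ^ 2 - z * z) with 1; [unfold Rdiv; ring|]. rewrite S2. lra.
  - unfold lame_q, gap_q. rewrite Ec, Es, Hden, Hnu, <- S2, <- RtoC_pow.
    assert (Hy2 : y ^ 2 <> 0) by (simpl; nra). unfold Cdiv. rewrite <- RtoC_inv by exact Hy2.
    transitivity (a' * (RtoC 4 * RtoC (/ y ^ 2) * RtoC ((y / (2 * z)) ^ 2))
                  + b * (RtoC 4 * RtoC (z ^ 2 / y ^ 2) * RtoC ((y / (2 * z)) ^ 2)))%C; [|ring].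
    rewrite <- !RtoC_mult.
    replace (4 * / y ^ 2 * (y / (2 * z)) ^ 2) with (/ (z * z)) by (field; lra).
    replace (4 * (z ^ 2 / y ^ 2) * (y / (2 * z)) ^ 2) with 1 by (field; lra).
    ring.
Qed.

(** The singular point [beta0] seen from the side [eps]: there [cos beta] has the
    sign [kappa]. *)
Definition oriented_end (beta0 eps kappa : R) : Prop :=
  (eps = 1 \/ eps = -1) /\ (kappa = 1 \/ kappa = -1) /\
  forall t, cos (beta0 + eps * t) = kappa * sin t /\ sin (beta0 + eps * t) = - eps * kappa * cos t.

Lemma star_to_gap (a b : C) (beta0 eps kappa lo hi r : R) (T : R -> C) :
  oriented_end beta0 eps kappa ->
  0 < r <= PI -> (forall t, 0 < t < r -> lo < beta0 + eps * t < hi) ->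
  solves_star a b lo hi T ->
  solves_gap (RtoC kappa * a)%C b 0 r (fun t => T (beta0 + eps * t)).
Proof.
  intros (He & Hk & Ho) Hr Hin.
  apply (solves_change_var _ _ _ _ (fun t => beta0 + eps * t) (fun _ => eps) (fun _ => 0)).
  intros t h1 h2. simpl in h1, h2.
  refine (conj (Hin t (conj h1 h2)) (conj _ (conj _ (conj _ _)))).
  - auto_derive; [easy|ring].
  - apply (@is_derive_const R_AbsRing R_NormedModule).
  - destruct (Ho t) as [Hc Hs]. assert (S0 := sin_gt_0 t ltac:(lra) ltac:(lra)).
    rewrite <- RtoC_opp, <- RtoC_pow, <- !RtoC_mult, <- RtoC_plus. f_equal.
    unfold tan, gap_p. rewrite Hc, Hs.
    destruct He as [->| ->], Hk as [->| ->]; field; lra.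
  - destruct (Ho t) as [Hc Hs]. assert (S0 := sin_gt_0 t ltac:(lra) ltac:(lra)).
    unfold gap_q. rewrite Hc, <- RtoC_pow.
    replace (eps ^ 2) with 1 by (destruct He as [->| ->]; ring).
    unfold Cdiv. rewrite <- RtoC_inv by (destruct Hk as [->| ->]; lra).
    replace (/ (kappa * sin t)) with (kappa * / sin t) by (destruct Hk as [->| ->]; field; lra).
    rewrite RtoC_mult. ring.
Qed.

Lemma gap_to_star (a b : C) (beta0 eps kappa lo hi r : R) (T : R -> C) :
  oriented_end beta0 eps kappa ->
  0 < r <= PI -> (forall beta, lo < beta < hi -> 0 < eps * (beta - beta0) < r) ->
  solves_gap (RtoC kappa * a)%C b 0 r T ->
  solves_star a b lo hi (fun beta => T (eps * (beta - beta0))).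
Proof.
  intros (He & Hk & Ho) Hr Hin.
  apply (solves_change_var _ _ _ _ (fun beta => eps * (beta - beta0)) (fun _ => eps) (fun _ => 0)).
  intros beta h1 h2. simpl in h1, h2. assert (Ht := Hin beta (conj h1 h2)).
  refine (conj Ht (conj _ (conj _ _))).
  - auto_derive; [easy|ring].
  - apply (@is_derive_const R_AbsRing R_NormedModule).
  - set (t := eps * (beta - beta0)) in *.
    assert (Hb : beta = beta0 + eps * t) by (unfold t; destruct He as [->| ->]; ring).
    destruct (Ho t) as [Hc Hs]. rewrite <- Hb in Hc, Hs.
    assert (S0 := sin_gt_0 t ltac:(lra) ltac:(lra)). split.
    + rewrite <- RtoC_opp, <- RtoC_pow, <- !RtoC_mult, <- RtoC_plus. f_equal.
      unfold tan, gap_p. rewrite Hc, Hs.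
      destruct He as [->| ->], Hk as [->| ->]; field; lra.
    + unfold gap_q. rewrite Hc, <- RtoC_pow.
      replace (eps ^ 2) with 1 by (destruct He as [->| ->]; ring).
      unfold Cdiv. rewrite <- RtoC_inv by (destruct Hk as [->| ->]; lra).
      replace (/ (kappa * sin t)) with (kappa * / sin t) by (destruct Hk as [->| ->]; field; lra).
      rewrite RtoC_mult. ring.
Qed.

Lemma star_to_lame (a b nu : C) (beta0 eps kappa lo hi r : R) (T : R -> C) :
  (nu * (nu + 1) = 4 * b)%C -> oriented_end beta0 eps kappa ->
  0 < r <= PI -> (forall t, 0 < t < r -> lo < beta0 + eps * t < hi) ->
  solves_star a b lo hi T ->
  solves_lame_on nu (4 * (RtoC kappa * a))%C 0 (gap_inv r) (fun s => T (beta0 + eps * gap s)).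
Proof.
  intros Hnu Ho Hr Hin HT. apply (gap_to_lame _ b nu r (fun t => T (beta0 + eps * t))); auto.
  eapply star_to_gap; eauto.
Qed.

Lemma lame_to_star (a b nu : C) (beta0 eps kappa lo hi r : R) (T : R -> C) :
  (nu * (nu + 1) = 4 * b)%C -> oriented_end beta0 eps kappa ->
  0 < r <= PI -> (forall beta, lo < beta < hi -> 0 < eps * (beta - beta0) < r) ->
  solves_lame_on nu (4 * (RtoC kappa * a))%C 0 (gap_inv r) T ->
  solves_star a b lo hi (fun beta => T (gap_inv (eps * (beta - beta0)))).
Proof.
  intros Hnu Ho Hr Hin HT.
  apply (gap_to_star a b beta0 eps kappa lo hi r (fun t => T (gap_inv t))); auto.
  now apply (lame_to_gap _ b nu).
Qed.

(** * Jets of the Frobenius solutions *)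

(** Carathéodory's form of differentiability at 0, with [is_derive_of_slope] as
    its converse. *)
Lemma slope_continuous (k : R -> R) (l : R) :
  is_derive k 0 l -> k 0 = 0 ->
  exists sl : R -> R, continuity_pt sl 0 /\ sl 0 = l /\ forall h, k h = h * sl h.
Proof.
  intros Hk K0. apply is_derive_Reals in Hk.
  exists (fun h => if Req_dec_T h 0 then l else k h / h).
  refine (conj _ (conj _ _)).
  - intros eps Heps. destruct (Hk eps Heps) as [d Hd]. exists d. split; [apply cond_pos|].
    intros x [_ Hx]. simpl in *. unfold Rdist in *. 
    destruct (Req_dec_T 0 0) as [_|h]; [|lra].
    destruct (Req_dec_T x 0) as [->|Hne]; [rewrite Rminus_diag, Rabs_R0; exact Heps|].
    rewrite Rminus_0_r in Hx. specialize (Hd x Hne Hx).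
    rewrite Rplus_0_l, K0, Rminus_0_r in Hd. exact Hd.
  - destruct (Req_dec_T 0 0); [easy|lra].
  - intros h. destruct (Req_dec_T h 0) as [->|Hne]; [rewrite K0; ring|field; exact Hne].
Qed.

Lemma is_derive_of_slope (k sl : R -> R) :
  continuity_pt sl 0 -> (forall h, k h = h * sl h) -> is_derive k 0 (sl 0).
Proof.
  intros Hc Hk. apply is_derive_Reals. intros eps Heps.
  destruct (Hc eps Heps) as (d & Hd & H). exists (mkposreal d Hd). simpl. intros h Hh Hhd.
  rewrite Rplus_0_l, !Hk.
  replace ((h * sl h - 0 * sl 0) / h) with (sl h) by (field; exact Hh).
  apply (H h). split; [split; [exact I|auto]|]. simpl. unfold Rdist. now rewrite Rminus_0_r.
Qed.

(** For [0 < s < PI / 2] one has [gap s = asin (sin s ^ 2)], and [asin y = y E y]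
    with [E] continuous and [E 0 = 1].  So [sqrt (gap s)] is
    [sin s * sqrt (E (sin s ^ 2))], which is differentiable at 0. *)
Lemma sqrt_gap_odd_extension :
  exists (v : R -> R) (l : R), v 0 = 0 /\ is_derive v 0 l /\
    forall s, 0 < s < PI / 2 -> v s = sqrt (gap s).
Proof.
  assert (PP := PI_RGT_0).
  assert (Hasin : is_derive asin 0 1).
  { apply is_derive_Reals. apply (derive_pt_eq_1 asin 0 _ (derivable_pt_asin 0 ltac:(lra))).
    rewrite derive_pt_asin. unfold Rsqr. rewrite Rmult_0_l, Rminus_0_r, sqrt_1. field. }
  destruct (slope_continuous asin 1 Hasin asin_0) as (E & Ec & E0 & Eeq).
  assert (Hsin : is_derive sin 0 1).
  { apply is_derive_Reals. rewrite <- cos_0. apply derivable_pt_lim_sin. }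
  destruct (slope_continuous sin 1 Hsin sin_0) as (S & Sc & S0 & Seq).
  set (sl := fun s => S s * sqrt (E (sin s * sin s))).
  exists (fun s => s * sl s), (sl 0). refine (conj (Rmult_0_l _) (conj _ _)).
  - apply is_derive_of_slope; [|easy].
    apply continuity_pt_mult; [exact Sc|].
    assert (C1 : continuity_pt (fun s => sin s * sin s) 0).
    { apply continuity_pt_mult; apply continuity_sin. }
    apply (continuity_pt_comp (fun s => E (sin s * sin s)) sqrt 0).
    + apply (continuity_pt_comp (fun s => sin s * sin s) E 0); [exact C1|].
      now rewrite sin_0, Rmult_0_l.
    + apply continuity_pt_sqrt. rewrite sin_0, Rmult_0_l, E0. lra.
  - intros s Hs. assert (Hp := sin_gt_0 s ltac:(lra) ltac:(lra)).
    assert (Hw : gap s = asin (sin s * sin s)).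
    { replace (sin s * sin s) with (sin (gap s)) by (rewrite sin_gap; ring).
      symmetry. apply asin_sin.
      assert (W0 := gap_range s ltac:(lra)). split; [lra|].
      assert (Hw := gap_increasing s (PI / 2) ltac:(lra) ltac:(lra) ltac:(lra)).
      assert (gap (PI / 2) = PI / 2); [|lra].
      unfold gap. rewrite cos_PI2. unfold Rdiv at 1. rewrite Rmult_0_l, acos_0. field. }
    rewrite Hw, Eeq. unfold sl. rewrite <- Rmult_assoc, <- Seq.
    assert (HE : 0 < E (sin s * sin s)).
    { assert (W0 := gap_range s ltac:(lra)). rewrite Hw, Eeq in W0. nra. }
    rewrite sqrt_mult, sqrt_square by nra. ring.
Qed.

(** The real derivative along the real axis of a complex differentiable function,
    obtained by applying the real and the imaginary part to the complex
    difference quotients. *)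
Lemma holomorphic_derivC (psi : C -> C) :
  holomorphic_near_0 psi -> exists l, derivC (fun x => psi (RtoC x)) 0 l.
Proof.
  intros H. destruct (locally_singleton _ _ H) as [l [_ Hl]].
  exists l.
  assert (Hd : forall eps, 0 < eps -> exists d, 0 < d /\ forall h, Rabs h < d ->
    Cmod (psi (RtoC h) - psi (RtoC 0) - RtoC h * l)%C <= eps * Rabs h).
  { intros eps Heps.
    destruct (Hl (RtoC 0) (fun P HP => HP) (mkposreal eps Heps)) as [d Hd].
    exists d. split; [apply cond_pos|]. intros h Hh.
    assert (K := Hd (RtoC h)). 
    assert (B : Cmod (RtoC h - RtoC 0)%C = Rabs h) by (rewrite <- RtoC_minus, Rminus_0_r; apply Cmod_R).
    assert (K2 : Cmod (psi (RtoC h) - psi (RtoC 0) - (RtoC h - RtoC 0) * l)%C <= eps * Cmod (RtoC h - RtoC 0)%C).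
    { apply K. change (Cmod (RtoC h - RtoC 0)%C < d). now rewrite B. }
    rewrite B in K2. replace (RtoC h - RtoC 0)%C with (RtoC h) in K2 by ring. exact K2. }
  assert (Comp : forall (pr : C -> R), (forall z, Rabs (pr z) <= Cmod z) ->
     (forall z1 z2, pr (z1 - z2)%C = pr z1 - pr z2) -> (forall (h : R) z, pr (RtoC h * z)%C = h * pr z) ->
     is_derive (fun x => pr (psi (RtoC x))) 0 (pr l)).
  { intros pr Hpr Hm Hs. apply is_derive_Reals. intros eps Heps.
    destruct (Hd (eps / 2) ltac:(lra)) as (d & Hdp & Hd').
    exists (mkposreal d Hdp). simpl. intros h Hh Hhd. rewrite Rplus_0_l.
    replace ((pr (psi (RtoC h)) - pr (psi (RtoC 0))) / h - pr l)
      with (pr (psi (RtoC h) - psi (RtoC 0) - RtoC h * l)%C / h)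
      by (rewrite !Hm, Hs; field; exact Hh).
    unfold Rdiv. rewrite Rabs_mult, Rabs_inv.
    assert (Hp := Rabs_pos_lt h Hh).
    apply (Rmult_lt_reg_r (Rabs h)); [exact Hp|]. rewrite Rmult_assoc, Rinv_l, Rmult_1_r by lra.
    eapply Rle_lt_trans; [apply Hpr|]. eapply Rle_lt_trans; [apply Hd', Hhd|]. nra. }
  apply derivC_iff. split; apply Comp.
  - intros z. eapply Rle_trans; [apply Rmax_l|apply Rmax_Cmod].
  - intros; reflexivity.
  - intros; simpl; ring.
  - intros z. eapply Rle_trans; [apply Rmax_r|apply Rmax_Cmod].
  - intros; reflexivity.
  - intros; simpl; ring.
Qed.

(** The derivative is 0 whatever [psi] is, since [gap] has derivative 0 at 0. *)
Lemma derivC_psi_gap (psi : C -> C) (eps : R) :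
  holomorphic_near_0 psi -> derivC (fun s => psi (RtoC (eps * gap s))) 0 (RtoC 0).
Proof.
  intros H. destruct (holomorphic_derivC psi H) as [l Hl].
  apply (derivC_val _ _ (RtoC 0 * l)%C); [ring|].
  apply (derivC_comp (fun x => psi (RtoC x)) (fun s => eps * gap s)).
  - now rewrite gap_0, Rmult_0_r.
  - replace 0 with (eps * (2 * sin 0 / sqrt (2 - cos 0 ^ 2))) at 2
      by (rewrite sin_0; unfold Rdiv; ring).
    apply is_derive_scal, is_derive_gap.
Qed.

Lemma parity_jet_regular (psi : C -> C) (eps : R) :
  holomorphic_near_0 psi -> parity_jet true (fun s => psi (RtoC (eps * gap s))).
Proof.
  intros H. exists (psi (RtoC (eps * gap 0))), (RtoC 0). split; [|reflexivity].
  exists (fun s => psi (RtoC (eps * gap s))), 1.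
  refine (conj Rlt_0_1 (conj (derivC_psi_gap psi eps H) (conj eq_refl _))). easy.
Qed.

(** For [eps = -1] the principal square root contributes the constant factor
    [Ci], which does not affect the parity. *)
Lemma parity_jet_root (psi : C -> C) (eps : R) :
  eps = 1 \/ eps = -1 ->
  holomorphic_near_0 psi ->
  parity_jet false (fun s => sqrtRC (eps * gap s) * psi (RtoC (eps * gap s)))%C.
Proof.
  intros He H. destruct sqrt_gap_odd_extension as (v & l & V0 & Vd & Vs).
  assert (PP := PI_RGT_0).
  assert (Hroot : exists z : C, forall s, 0 < s < PI / 2 -> sqrtRC (eps * gap s) = (z * RtoC (v s))%C).
  { destruct He as [->| ->].
    - exists (RtoC 1). intros s Hs. rewrite Vs by exact Hs.
      assert (W := gap_range s ltac:(lra)). unfold sqrtRC.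
      destruct Rle_dec; [|lra]. rewrite Rmult_1_l. ring.
    - exists Ci. intros s Hs. rewrite Vs by exact Hs.
      assert (W := gap_range s ltac:(lra)). unfold sqrtRC.
      destruct Rle_dec; [lra|]. do 3 f_equal. ring. }
  destruct Hroot as [z Hz].
  set (Hf := fun s => (z * RtoC (v s) * psi (RtoC (eps * gap s)))%C).
  assert (D : exists L, derivC Hf 0 L).
  { eexists. apply (derivC_mult (fun s => z * RtoC (v s))%C).
    - apply (derivC_mult (fun _ => z)); [apply derivC_const|]. apply derivC_RtoC, Vd.
    - apply derivC_psi_gap, H. }
  destruct D as [L HL]. exists (RtoC 0), L. split; [|reflexivity].
  exists Hf, (PI / 2). refine (conj _ (conj HL (conj _ _))).
  - lra.
  - unfold Hf. rewrite V0. ring.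
  - intros s Hs. unfold Hf. now rewrite Hz.
Qed.

(** * Connection matrices *)

Lemma frobenius_side (a b : C) (beta0 eps : R) (psi1 psi2 : C -> C) :
  eps = 1 \/ eps = -1 -> frobenius_basis a b beta0 psi1 psi2 ->
  exists r lo hi, 0 < r <= PI /\
    basis_of_solutions a b lo hi (frobenius_vector beta0 psi1 psi2) /\
    (forall t, 0 < t < r -> lo < beta0 + eps * t < hi) /\
    (forall beta, lo < beta < hi -> 0 < eps * (beta - beta0) < r).
Proof.
  intros He (_ & _ & r & Hr & Hl & Hh). destruct He as [->| ->].
  - exists r, beta0, (beta0 + r). repeat split; try apply Hh; try lra.
  - exists r, (beta0 - r), beta0. repeat split; try apply Hl; try lra.
Qed.

(** Both variables describe the same solutions on a one-sided neighbourhood, so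
    spanning and independence carry over; the parities are those of the
    exponents 0 and 1/2. *)
Lemma frobenius_end_basis (a b nu : C) (beta0 eps kappa : R) (psi1 psi2 : C -> C) :
  (nu * (nu + 1) = 4 * b)%C -> oriented_end beta0 eps kappa ->
  frobenius_basis a b beta0 psi1 psi2 ->
  end_basis nu (4 * (RtoC kappa * a))%C true
    (fun s => entry (frobenius_vector beta0 psi1 psi2 (beta0 + eps * gap s)) 0 0)
    (fun s => entry (frobenius_vector beta0 psi1 psi2 (beta0 + eps * gap s)) 1 0).
Proof.
  intros Hnu Ho HB. assert (He := proj1 Ho).
  destruct (frobenius_side a b beta0 eps psi1 psi2 He HB) as (r & lo & hi & Hr & HBs & Hin & Hout).
  destruct HB as (Hpsi1 & Hpsi2 & _). destruct HBs as (S1 & S2 & Hbasis).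
  assert (Harg : forall s, beta0 + eps * gap s - beta0 = eps * gap s) by (intros; ring).
  assert (Bd := gap_inv_bounds r Hr).
  refine (conj _ (conj _ (ex_intro _ (gap_inv r) (conj Bd (conj _ (conj _ (conj _ _))))))).
  - apply (parity_jet_ext true (fun s => psi1 (RtoC (eps * gap s))) _ 1); [lra| |now apply parity_jet_regular].
    intros s _. unfold entry, frobenius_vector. rewrite coeff_mat_bij by auto. now rewrite Harg.
  - apply (parity_jet_ext false (fun s => sqrtRC (eps * gap s) * psi2 (RtoC (eps * gap s)))%C _ 1);
      [lra| |now apply parity_jet_root].
    intros s _. unfold entry, frobenius_vector. rewrite coeff_mat_bij by auto. now rewrite Harg.
  - exact (star_to_lame a b nu beta0 eps kappa lo hi r _ Hnu Ho Hr Hin S1).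
  - exact (star_to_lame a b nu beta0 eps kappa lo hi r _ Hnu Ho Hr Hin S2).
  - intros T HT.
    destruct (Hbasis _ (lame_to_star a b nu beta0 eps kappa lo hi r T Hnu Ho Hr Hout HT)) as ([c1 c2] & E & _).
    exists c1, c2. intros s Hs. assert (Hw := gap_below r s Hr Hs).
    etransitivity; [|exact (E (beta0 + eps * gap s) (Hin _ Hw))].
    rewrite Harg. replace (eps * (eps * gap s)) with (gap s) by (destruct He as [->| ->]; ring).
    now rewrite gap_inv_gap by lra.
  - intros c1 c2 E0.
    destruct (Hbasis (fun _ => RtoC 0) (solves_zero _ _ _ _)) as (c & _ & Huniq).
    assert (K1 := Huniq (RtoC 0, RtoC 0)). assert (K2 := Huniq (c1, c2)).
    assert (E : (c1, c2) = (RtoC 0, RtoC 0)).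
    { rewrite <- K1, <- K2; [reflexivity| |].
      - intros beta Hb. assert (Ht := Hout beta Hb).
        assert (Hw := gap_inv_below r _ Ht (proj2 Hr)).
        assert (EE := E0 _ Hw). cbv beta in EE. rewrite gap_gap_inv in EE by lra.
        replace (beta0 + eps * (eps * (beta - beta0))) with beta in EE
          by (destruct He as [->| ->]; ring).
        now symmetry.
      - intros beta _. simpl. ring. }
    now injection E.
Qed.

(** The first row of [A] gives [u = A00 v0 + A01 v1] with [v0] even and [v1] odd
    at the far end, and the coefficient of the element of the wrong parity is the
    one that must vanish.  The far end is seen from the side [- eps] with the same
    [kappa]: the cosine keeps its sign along the segment. *)
Lemma connection_entry (a b nu : C) (beta0 beta1 eps kappa lo hi : R) (e : bool)
    (psi1 psi2 phi1 phi2 : C -> C) (A : @matrix C_Ring 2 2) :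
  (nu * (nu + 1) = 4 * b)%C -> oriented_end beta0 eps kappa -> beta1 = beta0 + eps * PI ->
  (forall t, 0 < t < PI -> lo < beta0 + eps * t < hi) ->
  frobenius_basis a b beta0 psi1 psi2 -> frobenius_basis a b beta1 phi1 phi2 ->
  connection_matrix a b lo hi beta0 (frobenius_vector beta0 psi1 psi2)
    beta1 (frobenius_vector beta1 phi1 phi2) A ->
  entry A 0 (if e then 1 else 0) = RtoC 0 <->
  exists F : R -> C, nontrivial F /\ solves_lame nu (4 * (RtoC kappa * a))%C F /\
    (forall x, F x = F (- x)) /\ (forall x, F x = parity_sign e * F (2 * PI - x)%R)%C.
Proof.
  intros Hnu Ho Hb1 Hin HB0 HB1 (U & U' & (SU0 & _ & r0 & Hr0 & HU) & (SV0 & SV1 & r1 & Hr1 & HV) & HA).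
  assert (PP := PI_RGT_0). destruct (Ho) as (He & Hk & Hcs).
  assert (Ho1 : oriented_end beta1 (- eps) kappa).
  { split; [destruct He as [->| ->]; lra|]. split; [exact Hk|]. intros t.
    replace (beta1 + - eps * t) with (beta0 + eps * (PI + -1 * t)) by (rewrite Hb1; ring).
    destruct (Hcs (PI + -1 * t)) as [-> ->]. rewrite sin_PI_sub, cos_PI_sub. split; ring. }
  assert (Bas0 := frobenius_end_basis a b nu beta0 eps kappa psi1 psi2 Hnu Ho HB0).
  assert (Bas1 := frobenius_end_basis a b nu beta1 (- eps) kappa phi1 phi2 Hnu Ho1 HB1).
  assert (WPI : gap_inv PI = PI).
  { unfold gap_inv. replace (PI / 2 + PI / 4) with (PI + -1 * (PI / 4)) by field.
    rewrite cos_PI_sub, cos_PI4. assert (P2 := sqrt2_pos).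
    replace (sqrt 2 * - (1 / sqrt 2)) with (Ropp 1) by (field; lra).
    rewrite acos_opp, acos_1. ring. }
  assert (Pull : forall T, solves_star a b lo hi T ->
    solves_lame_on nu (4 * (RtoC kappa * a))%C 0 PI (fun s => T (beta0 + eps * gap s))).
  { intros T HT. rewrite <- WPI at 1. 
    apply (star_to_lame a b nu beta0 eps kappa lo hi PI T Hnu Ho); auto. lra. }
  set (rm := Rmin (Rmin r0 r1) PI).
  assert (Hrm : 0 < rm <= PI /\ rm <= r0 /\ rm <= r1).
  { unfold rm. repeat split.
    - repeat apply Rmin_glb_lt; lra.
    - apply Rmin_r.
    - eapply Rle_trans; apply Rmin_l.
    - eapply Rle_trans; [apply Rmin_l|apply Rmin_r]. }
  destruct Hrm as (Hrm & Hm0 & Hm1).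
  assert (Bw := gap_inv_bounds rm Hrm).
  assert (Habs : forall z, 0 < z -> Rabs (eps * z) = z).
  { intros z Hz. rewrite Rabs_mult, (Rabs_right z) by lra.
    destruct He as [->| ->]; [rewrite Rabs_right|rewrite Rabs_left]; lra. }
  assert (Eu : forall s, 0 < s < gap_inv rm ->
     U (beta0 + eps * gap s) = frobenius_vector beta0 psi1 psi2 (beta0 + eps * gap s)).
  { intros s Hs. assert (Hw := gap_below rm s Hrm Hs). apply HU; [apply Hin; lra|].
    replace (beta0 + eps * gap s - beta0) with (eps * gap s) by ring. rewrite Habs; lra. }
  assert (Ev : forall s, 0 < s < gap_inv rm ->
     U' (beta0 + eps * gap (PI - s)) = frobenius_vector beta1 phi1 phi2 (beta1 + - eps * gap s)).
  { intros s Hs. assert (Hw := gap_below rm s Hrm Hs). rewrite gap_reflect.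
    replace (beta0 + eps * (PI - gap s)) with (beta1 + - eps * gap s) by (rewrite Hb1; ring).
    apply HV.
    - replace (beta1 + - eps * gap s) with (beta0 + eps * (PI - gap s)) by (rewrite Hb1; ring).
      apply Hin. lra.
    - replace (beta1 + - eps * gap s - beta1) with (- (eps * gap s)) by ring.
      rewrite Rabs_Ropp, Habs; lra. }
  assert (Em : forall s, 0 < s < PI ->
     entry (U (beta0 + eps * gap s)) 0 0 =
     (entry A 0 0 * entry (U' (beta0 + eps * gap s)%R) 0 0 +
      entry A 0 1 * entry (U' (beta0 + eps * gap s)%R) 1 0)%C).
  { intros s Hs. assert (Hw := gap_range s Hs). rewrite HA by (apply Hin, Hw).
    unfold entry, Mmult. rewrite coeff_mat_bij by auto. simpl. rewrite sum_Sn, sum_O. reflexivity. }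
  destruct e.
  - eapply (matching nu _ true _ _ _ _ _ _ _ (entry A 0 0) (entry A 0 1) (gap_inv rm) Bas0 Bas1
      (Pull _ SU0) (Pull _ SV0) (Pull _ SV1)); try lra.
    + intros s Hs. cbv beta. now rewrite Eu.
    + intros s Hs. cbv beta. now rewrite Ev.
    + intros s Hs. cbv beta. now rewrite Ev.
    + exact Em.
  - eapply (matching nu _ false _ _ _ _ _ _ _ (entry A 0 1) (entry A 0 0) (gap_inv rm) Bas0 
      (end_basis_swap _ _ _ _ _ Bas1)
      (Pull _ SU0) (Pull _ SV1) (Pull _ SV0)); try lra.
    + intros s Hs. cbv beta. now rewrite Eu.
    + intros s Hs. cbv beta. now rewrite Ev.
    + intros s Hs. cbv beta. now rewrite Ev.
    + intros s Hs. cbv beta. rewrite Em by exact Hs. ring.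
Qed.

Theorem proposition3p9 (a b nu : C)
    (hnu : (nu * (nu + 1) = 4 * b)%C)
    (psi11 psi21 psi12 psi22 psi13 psi23 : C -> C)
    (hB1 : frobenius_basis a b (- (PI / 2)) psi11 psi21)
    (hB2 : frobenius_basis a b (PI / 2) psi12 psi22)
    (hB3 : frobenius_basis a b (3 * PI / 2) psi13 psi23)
    (M N : @matrix C_Ring 2 2)
    (hM : connection_matrix a b (- (PI / 2)) (PI / 2)
            (PI / 2) (frobenius_vector (PI / 2) psi12 psi22)
            (- (PI / 2)) (frobenius_vector (- (PI / 2)) psi11 psi21) M)
    (hN : connection_matrix a b (PI / 2) (3 * PI / 2)
            (PI / 2) (frobenius_vector (PI / 2) psi12 psi22)
            (3 * PI / 2) (frobenius_vector (3 * PI / 2) psi13 psi23) N) :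
  (entry M 0 0 = RtoC 0 /\ entry N 0 1 = RtoC 0) <->
  (exists TL TR : R -> C,
     (nontrivial TL /\ solves_lame nu (- (4 * a))%C TL /\
      (forall chi : R, TL chi = TL (- chi)) /\
      (forall chi : R, TL chi = TL (2 * PI - chi))) /\
     (nontrivial TR /\ solves_lame nu (4 * a)%C TR /\
      (forall tau : R, TR tau = TR (- tau)) /\
      (forall tau : R, TR tau = (- TR (2 * PI - tau)%R)%C))).
Proof.
  (* Right of [PI / 2] the cosine is negative, left of it positive. *)
  assert (OL : oriented_end (PI / 2) 1 (-1)).
  { split; [lra|split; [lra|]]. intros t.
    replace (PI / 2 + 1 * t) with (PI / 2 - (- t)) by ring.
    rewrite cos_shift, sin_shift, sin_neg, cos_neg. split; ring. }
  assert (OR : oriented_end (PI / 2) (-1) 1).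
  { split; [lra|split; [lra|]]. intros t.
    replace (PI / 2 + -1 * t) with (PI / 2 - t) by ring.
    rewrite cos_shift, sin_shift. split; ring. }
  assert (HL := connection_entry a b nu (PI / 2) (3 * PI / 2) 1 (-1) (PI / 2) (3 * PI / 2) true
     psi12 psi22 psi13 psi23 N hnu OL ltac:(field) ltac:(intros; lra) hB2 hB3 hN).
  assert (HR := connection_entry a b nu (PI / 2) (- (PI / 2)) (-1) 1 (- (PI / 2)) (PI / 2) false
     psi12 psi22 psi11 psi21 M hnu OR ltac:(field) ltac:(intros; lra) hB2 hB1 hM).
  simpl in HL, HR.
  replace (4 * (RtoC (-1) * a))%C with (- (4 * a))%C in HL by (rewrite RtoC_m1; ring).
  replace (4 * (RtoC 1 * a))%C with (4 * a)%C in HR by ring.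
  rewrite HL, HR. clear. split.
  - intros [(TR & R1 & R2 & R3 & R4) (TL & L1 & L2 & L3 & L4)].
    exists TL, TR. repeat split; auto.
    + intros x. rewrite (L4 x) at 1. ring.
    + intros x. rewrite (R4 x) at 1. ring.
  - intros (TL & TR & (L1 & L2 & L3 & L4) & (R1 & R2 & R3 & R4)). split.
    + exists TR. repeat split; auto. intros x. rewrite (R4 x) at 1. ring.
    + exists TL. repeat split; auto. intros x. rewrite (L4 x) at 1. ring.
Qed.
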